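(* The space $(\mathbb R^3,d_{CC})$ is ideal in the following sense. (1) There are no abnormal length minimizers: no constant-speed length minimizer $\gamma:[0,T]\to\mathbb R^3$ admits an absolutely continuous covector lift $\lambda(t)$, not identically zero, with $H_f(\gamma(t),\lambda(t))=0$ for all $t\in[0,T]$. (2) Every nonconstant normal trajectory is a geodesic.
   Context: Let $\mathfrak F$ be the set of $f\in C^0[0,\infty)$ satisfying the following: (i) $f(r)>0$ for $r>0$ and $f(0)=0$; (ii) $f|_{(0,\infty)}\in C^2(0,\infty)$; (iii) $f(r)\dot f(r)/r$ extends continuously to $r=0$; (iv) $f$ is strictly increasing and $f(r)\to+\infty$ as $r\to+\infty$; (v) $f(r)^2/\dot f(r)\to+\infty$ as $r\to+\infty$. Fix $f\in\mathfrak F$. On $\mathbb R^3$ write points as $q=(x,y,z)$ and set $r=\sqrt{x^2+y^2}$. Let $X=\partial_x$, $Y=\partial_y$, $Z_f=f(r)\partial_z$, and let $\Sigma=\{r=0\}$. Admissible curves, length and $d_{CC}$: - An absolutely continuous $\gamma:[0,T]\to\mathbb R^3$ is admissible if $\gamma'=u_1X+u_2Y+u_3Z_f$ a.e. for some $u\in L^2([0,T];\mathbb R^3)$. - Its length is $\ell(\gamma)=\int_0^T\sqrt{\dot x^2+\dot y^2+\dot z^2/f(r)^2}\,dt$. - $d_{CC}(q,q')$ is the infimum of $\ell(\gamma)$ over admissible curves from $q$ to $q'$. Minimizers and geodesics: - An admissible $\gamma$ is a length minimizer if $\ell(\gamma)\le\ell(\tilde\gamma)$ for every admissible $\tilde\gamma$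 with the same endpoints. - $\gamma$ is a geodesic if for every $t\in[0,T)$ there is $\varepsilon>0$ such that $\gamma|_{[t,t+\varepsilon]}$ is a length minimizer parametrized with constant speed. Hamiltonian and normal trajectories: - The Hamiltonian is $H_f(q,\lambda)=\tfrac12(u^2+v^2+f(r)^2w^2)$ on $T^*\mathbb R^3\cong\mathbb R^3\times\mathbb R^3$, with $\lambda=(u,v,w)$. - Normal trajectories are the projections $\gamma=(x,y,z)$ of solutions of Hamilton's equations $$\dot x=u,\quad \dot y=v,\quad \dot z=f(r)^2w,\quad \dot u=-w^2f(r)\dot f(r)\,x/r,\quad \dot v=-w^2f(r)\dot f(r)\,y/r,\quad \dot w=0.$$
   Formalization: In (1) the length minimizer is assumed nonconstant: a constant curve at a point of Σ is a constant-speed length minimizer and has the lift λ = (0,0,1) with H_f = 0, so the claim fails for it as stated. *)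

(* Defs.v *)
From HB Require Import structures.
From mathcomp Require Import all_boot all_order all_algebra.
From mathcomp Require Import all_classical all_reals all_analysis.
Set Implicit Arguments. Unset Strict Implicit. Unset Printing Implicit Defensive.
Import Order.TTheory GRing.Theory Num.Theory.
Import numFieldNormedType.Exports.
Local Open Scope classical_set_scope.
Local Open Scope ring_scope.

Section SR.
Variable R : realType.
Notation mu := (@lebesgue_measure R).

Definition abs_cont (a b : R) (g : R -> R) : Prop :=
  forall e : R, 0 < e -> exists2 d : R, 0 < d &
    forall (n : nat) (s t : 'I_n -> R),
      (forall i, a <= s i /\ s i <= t i /\ t i <= b) ->
      (forall i j, i != j -> t i <= s j \/ t j <= s i) ->
      \sum_(i < n) (t i - s i) < d ->
      \sum_(i < n) `|g (t i) - g (s i)| < e.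

Definition L2 (T : R) (u : R -> R) : Prop :=
  measurable_fun `[0, T] u /\
  (\int[mu]_(t in `[0%R, T]) ((u t) ^+ 2)%:E < +oo)%E.

Definition rad (x y : R -> R) (t : R) : R := Num.sqrt (x t ^+ 2 + y t ^+ 2).

Definition admissible (f : R -> R) (T : R) (x y z : R -> R) : Prop :=
  0 <= T /\ abs_cont 0 T x /\ abs_cont 0 T y /\ abs_cont 0 T z /\
  exists u1 u2 u3 : R -> R, L2 T u1 /\ L2 T u2 /\ L2 T u3 /\
    {ae mu, forall t, 0 <= t <= T ->
      derivable x t 1 /\ derivable y t 1 /\ derivable z t 1 /\
      derive1 x t = u1 t /\ derive1 y t = u2 t /\ derive1 z t = u3 t * f (rad x y t)}.

(* speed sqrt(x'^2 + y'^2 + z'^2/f(r)^2)   (note: 0/0 = 0 in MathComp) *)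
Definition speed (f : R -> R) (x y z : R -> R) (t : R) : R :=
  Num.sqrt (derive1 x t ^+ 2 + derive1 y t ^+ 2 + derive1 z t ^+ 2 / f (rad x y t) ^+ 2).

Definition length (f : R -> R) (T : R) (x y z : R -> R) : \bar R :=
  (\int[mu]_(t in `[0%R, T]) (speed f x y z t)%:E)%E.

Definition length_minimizer (f : R -> R) (T : R) (x y z : R -> R) : Prop :=
  admissible f T x y z /\
  forall (T' : R) (x' y' z' : R -> R), admissible f T' x' y' z' ->
    x' 0 = x 0 -> y' 0 = y 0 -> z' 0 = z 0 ->
    x' T' = x T -> y' T' = y T -> z' T' = z T ->
    (length f T x y z <= length f T' x' y' z')%E.

Definition constant_speed (f : R -> R) (T : R) (x y z : R -> R) : Prop :=
  exists c : R, {ae mu, forall t, 0 <= t <= T -> speed f x y z t = c}.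

Definition nonconstant (T : R) (x y z : R -> R) : Prop :=
  exists t, 0 <= t <= T /\ ~ (x t = x 0 /\ y t = y 0 /\ z t = z 0).

Definition Ham (f : R -> R) (x y z u v w : R) : R :=
  2^-1 * (u ^+ 2 + v ^+ 2 + f (Num.sqrt (x ^+ 2 + y ^+ 2)) ^+ 2 * w ^+ 2).

Definition abnormal_lift (f : R -> R) (T : R) (x y z : R -> R) : Prop :=
  exists lu lv lw : R -> R,
    abs_cont 0 T lu /\ abs_cont 0 T lv /\ abs_cont 0 T lw /\
    (exists t, 0 <= t <= T /\ ~ (lu t = 0 /\ lv t = 0 /\ lw t = 0)) /\
    (forall t, 0 <= t <= T -> Ham f (x t) (y t) (z t) (lu t) (lv t) (lw t) = 0).

(* gamma = (x,y,z) on [0,T] (T > 0) is the projection of a solution of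
   Hamilton's equations (continuous on [0,T], solving the ODE on ]0,T[).
   At r = 0 the term f f' x / r evaluates to 0, which is the value of the
   continuous extension (f f'/r)(0) * x. *)
Definition normal_trajectory (f : R -> R) (T : R) (x y z : R -> R) : Prop :=
  0 < T /\ exists u v w : R -> R,
    {within `[0, T], continuous x} /\ {within `[0, T], continuous y} /\
    {within `[0, T], continuous z} /\ {within `[0, T], continuous u} /\
    {within `[0, T], continuous v} /\ {within `[0, T], continuous w} /\
    forall t, 0 < t < T ->
      derivable x t 1 /\ derivable y t 1 /\ derivable z t 1 /\
      derivable u t 1 /\ derivable v t 1 /\ derivable w t 1 /\
      derive1 x t = u t /\ derive1 y t = v t /\ derive1 z t = f (rad x y t) ^+ 2 * w t /\
      derive1 u t = - (w t ^+ 2 * f (rad x y t) * derive1 f (rad x y t) * x t / rad x y t) /\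
      derive1 v t = - (w t ^+ 2 * f (rad x y t) * derive1 f (rad x y t) * y t / rad x y t) /\
      derive1 w t = 0.

Definition geodesic (f : R -> R) (T : R) (x y z : R -> R) : Prop :=
  forall t, 0 <= t < T -> exists2 e : R, 0 < e &
    t + e <= T /\
    length_minimizer f e (fun s => x (t + s)) (fun s => y (t + s)) (fun s => z (t + s)) /\
    constant_speed f e (fun s => x (t + s)) (fun s => y (t + s)) (fun s => z (t + s)).

Definition in_frakF (f : R -> R) : Prop :=
  ({within `[0, +oo[, continuous f} /\ f 0 = 0 /\ (forall r, 0 < r -> 0 < f r)) /\
  (forall r, 0 < r -> derivable f r 1 /\ derivable (derive1 f) r 1 /\
                      {for r, continuous (derive1 (derive1 f))}) /\
  (exists L : R, (fun r => f r * derive1 f r / r) @ 0^'+ --> L) /\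
  ((forall a b, 0 <= a -> a < b -> f a < f b) /\ (f r @[r --> +oo] --> +oo)) /\
  (* (v) f^2/f' -> +oo, phrased without division (f' may vanish) *)
  (forall M : R, \forall r \near +oo, M * derive1 f r < f r ^+ 2).

End SR.

(* Main.v *)
Require Import Defs.
From HB Require Import structures.
From mathcomp Require Import all_boot all_order all_algebra.
From mathcomp Require Import all_classical all_reals all_analysis.
From mathcomp Require Import measurable_realfun.
From mathcomp Require Import ring lra.
Import Order.TTheory GRing.Theory Num.Theory.
Import numFieldNormedType.Exports.
Local Open Scope classical_set_scope.
Local Open Scope ring_scope.

(* A covector lift annihilated by H_f is nonzero only while the curve stays on
   the axis, where an admissible curve has speed 0; constant speed then forces
   the curve to be constant.

   Normal trajectories are shown to minimize by calibration: one looks for S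
   with |dS|_H <= c near the trajectory and equality along it, and integrates
   dS along a competitor.  If r > 0 at the initial time, f^2 is C^2 there, and
   the time-dependent function
     S(q, t) = <lambda(t), q - gamma(t)> + c^2 t / 2 - (M / 2) t |q - gamma(t)|^2
   (norm taken in the (x, y)-plane) satisfies S_t + H(q, dS) <= 0 for small t
   once M is large; evaluated along a competitor at the time (arc length) / c
   it bounds the length from below.  If r = 0 at the initial time, f^2 need not
   be C^{1,1}, but the motion is radial, and S = w z + G(r) with
   G' = sqrt (c^2 - w^2 f^2) is a calibration; replacing r by sqrt (r^2 + k^2)
   keeps it a subsolution because f increases, and removes its singularity. *)

Set Implicit Arguments.
Unset Strict Implicit.
Unset Printing Implicit Defensive.

Local Notation rad := Defs.rad.

(** * Absolutely continuous functions *)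

(** Why there are two calibrations: condition (iii) bounds only f f'/r near the axis. This gives
    f(r)^2 = O(r^2) but no second-order expansion, so the quadratic ansatz is confined to r > 0.
    Conversely, w z + G(r) carries no angular momentum, which suits exactly the trajectories issuing
    from the axis. Off the axis a subsolution is enough, so no eikonal equation has to be solved by
    characteristics. With h the planar displacement from the trajectory, the factor t in the bending
    term does the work: its time derivative yields - (M / 2) |h|^2, which absorbs the second-order
    error of f^2, while its gradient M t h is small for small t. Competitors are merely absolutely
    continuous and arbitrarily parametrized. Every integration along them is therefore replaced by
    one fact: an absolutely continuous function with derivative <= 0 almost everywhere does not
    increase. Length enters only through an absolutely continuous F with F(T) <= length, whose
    derivative bounds the pairing of the velocity with covectors. *)

(** The supremum of the points reached is itself reached, and the step at that point carries the
    property beyond it unless it is [b]. The step only has to pass from the left of [t] to its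
    right, which is what a gauge provides. *)
Lemma real_induction (R : realType) (a b : R) (P : R -> Prop) :
  a <= b -> P a ->
  (forall t, a <= t <= b -> exists2 d : R, 0 < d &
     forall x y, a <= x -> x <= t -> t <= y -> y <= b ->
       t - d < x -> y < t + d -> P x -> P y) ->
  P b.
Proof.
move=> ab Pa step.
pose S := [set c | a <= c <= b /\ P c].
have Sa : S a by split=> //; rewrite lexx.
have supS : has_sup S by split; [exists a | exists b => c [/andP[]]].
have as_ : a <= sup S by apply: ub_le_sup => //; exact: supS.2.
have sb : sup S <= b by apply: ge_sup => [|c [/andP[]]//]; exists a.
have [|d d0 dP] := step (sup S); first by rewrite as_.
have [x [/andP[ax xb] Px] sdx] := sup_adherent d0 supS.
have xs : x <= sup S.
  by apply: ub_le_sup; [exact: supS.2 | split=> //; rewrite ax].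
have [bs|sltb] := leP b (sup S).
  by apply: (dP x b); rewrite // (le_lt_trans bs)// ltrDl.
pose y := Num.min b (sup S + d / 2).
have sy : sup S < y by rewrite lt_min sltb ltrDl divr_gt0.
have Py : P y.
  apply: (dP x y); rewrite // ?(ltW sy) ?ge_min ?lexx//.
  by rewrite gt_min ltrD2l ltr_pdivrMr// ltr_pMr// ltr1n orbT.
have : y <= sup S.
  apply: ub_le_sup; first exact: supS.2.
  by split=> //; rewrite (le_trans as_ (ltW sy)) ge_min lexx.
by rewrite leNgt sy.
Qed.

(** The increment is cut at [t], and each half is compared with the difference quotient at [t];
    hence the requirement that [x] and [y] lie on opposite sides. *)
Lemma derivable_straddle (R : realType) (p : R -> R) (t e : R) :
  derivable p t 1 -> derive1 p t <= 0 -> 0 < e ->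
  exists2 d : R, 0 < d & forall x y, x <= t -> t <= y ->
    t - d < x -> y < t + d -> p y - p x <= e * (y - x).
Proof.
move=> /cvg_ex[l hl] p0 e0.
have ll : l = derive1 p t by rewrite derive1E; apply/esym/cvg_lim.
move: hl; rewrite {}ll.
move=> /cvgrPdist_lt/(_ _ e0)[d /= d0 dP].
have key h : h != 0 -> `|h| < d -> h^-1 * (p (h + t) - p t) < e.
  move=> h0 hd; have := dP h; rewrite /= sub0r normrN => /(_ hd h0).
  rewrite ltr_norml => /andP[+ _]; rewrite /GRing.scale/= mulr1.
  move: p0; set X := derive1 _ _; set Y := _ * _; lra.
exists d => // x y xt ty tdx ytd.
have K1 : p y - p t <= e * (y - t).
  have [<-|ney] := eqVneq t y; first by rewrite !subrr mulr0.
  have yt : 0 < y - t by rewrite subr_gt0 lt_neqAle ney.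
  have := key (y - t); rewrite gt_eqF// gtr0_norm// subrK ltrBlDl.
  move=> /(_ isT ytd).
  by rewrite mulrC ltr_pdivrMr// => /ltW.
have K2 : p t - p x <= e * (t - x).
  have [<-|nex] := eqVneq x t; first by rewrite !subrr mulr0.
  have xt0 : x - t < 0 by rewrite subr_lt0 lt_neqAle nex.
  have := key (x - t); rewrite lt_eqF// ltr0_norm// subrK opprB.
  rewrite ltrBlDl -ltrBlDr => /(_ isT tdx).
  rewrite mulrC ltr_ndivrMr// => /ltW; lra.
by lra.
Qed.

(** Half-open intervals []p.1, p.2]] stay disjoint when neighbours share an endpoint, so their
    measures add up. The list runs from right to left, the order in which the induction prepends
    intervals. *)
Lemma sum_lengths_le (R : realType) (U : set R) (l : seq (R * R)) :
  measurable U ->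
  pairwise (fun p q => q.2 <= p.1) l ->
  (forall p, p \in l -> p.1 <= p.2 /\ `[p.1, p.2] `<=` U) ->
  ((\sum_(p <- l) (p.2 - p.1))%:E <= @lebesgue_measure R U)%E.
Proof.
move=> mU.
pose A := foldr (fun p : R * R => setU `]p.1, p.2]%classic) (set0 : set R).
suff H : pairwise (fun p q => q.2 <= p.1) l ->
  (forall p, p \in l -> p.1 <= p.2 /\ `[p.1, p.2] `<=` U) ->
  [/\ measurable (A l), A l `<=` U,
      forall c, (forall p, p \in l -> p.2 <= c) -> A l `<=` `]-oo, c] &
      @lebesgue_measure R (A l) = (\sum_(p <- l) (p.2 - p.1))%:E].
  move=> pl hl; have [mA AU _ <-] := H pl hl.
  by apply: le_measure => //; rewrite inE.
elim: l => [_ _|p l IH].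
  by split=> [||c _|]; rewrite /A /= ?big_nil ?measure0//; exact: sub0set.
rewrite pairwise_cons => /andP[/allP pl /IH{}IH] hl.
have [|mA AU Ac muA] := IH; first by move=> q ql; apply: hl; rewrite inE ql orbT.
have [p12 pU] := hl p (mem_head _ _).
split.
- by apply: measurableU => //; exact: measurable_itv.
- rewrite subUset; split=> // x /= xp; apply: pU; move: xp.
  by rewrite /= !in_itv/= => /andP[/ltW -> ->].
- move=> c hc; rewrite subUset; split=> [x|]; last first.
    by apply: Ac => q ql; apply: hc; rewrite inE ql orbT.
  by rewrite /= !in_itv/= => /andP[_ /le_trans]; apply; apply: hc; exact: mem_head.
- rewrite big_cons /A /= -/(A l) measureU//.
  + rewrite [X in (_ + X)%E]muA [X in (X + _)%E](lebesgue_measure_itv `]p.1, p.2])/=.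
    rewrite lte_fin EFinD; congr (_ + _)%E.
    case: ltP => [//|]; move=> h; have -> : p.1 = p.2 by apply/le_anti/andP.
    by rewrite subrr.
  + rewrite -subset0 => x [] /=; rewrite in_itv/= => /andP[px _] Ax.
    by have := Ac p.1 pl x Ax; rewrite /= in_itv/= leNgt px.
Qed.

(** Lists replace families indexed by ordinals, since the gauge induction adds one interval at a
    time. *)
Lemma abs_cont_seq (R : realType) (a b e : R) (g : R -> R) :
  abs_cont a b g -> 0 < e -> exists2 d : R, 0 < d &
    forall l : seq (R * R), pairwise (fun p q => q.2 <= p.1) l ->
      (forall p, p \in l -> [/\ a <= p.1, p.1 <= p.2 & p.2 <= b]) ->
      \sum_(p <- l) (p.2 - p.1) < d ->
      \sum_(p <- l) `|g p.2 - g p.1| < e.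
Proof.
move=> /[apply] -[d d0 dP]; exists d => // l pl hl.
rewrite !(big_nth (0, 0)) !big_mkord.
apply: (dP _ (fun i => (nth (0, 0) l i).1) (fun i => (nth (0, 0) l i).2)).
  by move=> i; have [] := hl (nth (0, 0) l i) (mem_nth _ (ltn_ord i)).
move=> i j ij; have := pairwiseP (0, 0) pl => /= H.
have [lij|lji|/val_inj eij] := ltngtP i j; last by rewrite eij eqxx in ij.
- by right; exact: (H i j (ltn_ord i) (ltn_ord j) lij).
- by left; exact: (H j i (ltn_ord j) (ltn_ord i) lji).
Qed.

(* A gauge argument: points of the exceptional null set are tagged with
   intervals inside an open set of small measure, where absolute continuity
   controls the increments; all other points use the derivative. *)
Lemma abs_cont_le (R : realType) (a b : R) (p : R -> R) :
  a <= b -> abs_cont a b p ->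
  {ae @lebesgue_measure R, forall t, a <= t <= b ->
     derivable p t 1 /\ derive1 p t <= 0} ->
  p b <= p a.
Proof.
move=> ab acp [N [mN N0 HN]].
apply/ler_addgt0Pr => e0 e0_gt0.
(* The error budget is [e * (b - a)] for the slopes at good points and [e] for the intervals around
   exceptional points. *)
pose e := e0 / (b - a + 1).
have ba1 : 0 < b - a + 1 by rewrite ltr_wpDl// subr_ge0.
have e_gt0 : 0 < e by rewrite divr_gt0.
suff : p b <= p a + (e * (b - a) + e).
  by rewrite -[X in _ + (_ + X)]mulr1 -mulrDr /e divfK// gt_eqF.
have [d d0 dP] := abs_cont_seq acp e_gt0.
have [|U [oU NU Ud]] := lebesgue_regularity_outer mN _ d0.
  by rewrite [X in (X < _)%E]N0.
have muU : (@lebesgue_measure R U < d%:E)%E.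
  rewrite -(setDUK NU) measureU//.
  - by rewrite [X in (X + _)%E]N0 add0e.
  - by apply: measurableD => //; exact: open_measurable.
  - by rewrite -subset0 => s [? []].
(* The list records the intervals spent on exceptional points up to [c]. They lie in [U], so their
   total length stays below [d], whatever their number. *)
pose P c := exists l : seq (R * R),
  [/\ pairwise (fun p q => q.2 <= p.1) l,
     (forall q, q \in l -> [/\ a <= q.1, q.1 <= q.2, q.2 <= c &
        `[q.1, q.2] `<=` U]) &
     p c - p a <= e * (c - a) + \sum_(q <- l) `|p q.2 - p q.1|].
suff [l [pl hl]] : P b.
  move=> h; rewrite -lerBlDl (le_trans h)// lerD2l ltW//.
  apply: dP => //; first by move=> q /hl[].
  rewrite -lte_fin (le_lt_trans _ muU)//; apply: sum_lengths_le => //.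
    exact: open_measurable.
  by move=> q /hl[].
apply: (@real_induction _ a) => //.
  by exists [::]; split=> //; rewrite !subrr mulr0 big_nil addr0.
move=> t /andP[ta tb].
have [Nt|Nt] := pselect (N t).
  have /= := open_nbhs_nbhs (conj oU (NU _ Nt)).
  move=> /nbhs_ballP[r /= r0 rU].
  exists r => // x y ax xt ty yb trx ytr [l [pl hl h]].
  exists ((x, y) :: l); split.
  - by rewrite pairwise_cons pl andbT; apply/allP => q /hl[].
  - move=> q; rewrite inE => /predU1P[->/=|/hl[? ? qx ?]]; last first.
      by split=> //; rewrite (le_trans qx)// (le_trans xt).
    split=> //; first exact: le_trans ty.
    move=> s /=; rewrite in_itv/= => /andP[xs sy]; apply: rU.
    by rewrite /ball/= ltr_distlC; apply/andP; split; lra.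
  - rewrite big_cons /=; have := ler_norm (p y - p x).
    have : 0 <= e * (y - x) by rewrite mulr_ge0// ?(ltW e_gt0)// subr_ge0; lra.
    by lra.
have [dt pt] : derivable p t 1 /\ derive1 p t <= 0.
  by apply: contrapT => H; apply: Nt; apply: HN => /= H'; apply/H/H'; rewrite ta.
have [r r0 rP] := derivable_straddle dt pt e_gt0.
exists r => // x y ax xt ty yb trx ytr [l [pl hl h]].
exists l; split=> //.
  by move=> q /hl[? ? qx ?]; split=> //; rewrite (le_trans qx)// (le_trans xt).
by have := rP x y xt ty trx ytr; lra.
Qed.

Lemma lebesgue_aeS (R : realType) (P Q : R -> Prop) :
  (forall t, P t -> Q t) -> {ae @lebesgue_measure R, forall t, P t} ->
  {ae @lebesgue_measure R, forall t, Q t}.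
Proof.
by move=> PQ; apply: (@filterS _ _ (ae_filter_ringOfSetsType _)).
Qed.

Lemma lebesgue_aeS2 (R : realType) (P1 P2 Q : R -> Prop) :
  (forall t, P1 t -> P2 t -> Q t) ->
  {ae @lebesgue_measure R, forall t, P1 t} ->
  {ae @lebesgue_measure R, forall t, P2 t} ->
  {ae @lebesgue_measure R, forall t, Q t}.
Proof.
by move=> PQ; apply: (@filterS2 _ _ (ae_filter_ringOfSetsType _)).
Qed.

(** * Closure properties of absolute continuity *)

(** Common source of the closure properties: each needs only a pointwise bound on increments. The
    [+ 1] beside [|K|] avoids a division by zero and allows any sign of [K]. *)
Lemma abs_cont_dom (R : realType) (a b K : R) (g1 g2 p : R -> R) :
  abs_cont a b g1 -> abs_cont a b g2 ->
  (forall s t, a <= s -> s <= t -> t <= b ->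
     `|p t - p s| <= K * (`|g1 t - g1 s| + `|g2 t - g2 s|)) ->
  abs_cont a b p.
Proof.
move=> ac1 ac2 H e e0.
pose e' := e / (2 * (`|K| + 1)).
have K1 : 0 < `|K| + 1 by rewrite ltr_wpDl.
have e'0 : 0 < e' by rewrite divr_gt0// mulr_gt0.
have [d1 d10 P1] := ac1 _ e'0; have [d2 d20 P2] := ac2 _ e'0.
exists (Num.min d1 d2); first by rewrite lt_min d10.
move=> n s t hst disj; rewrite lt_min => /andP[l1 l2].
have {P1 l1} := P1 n s t hst disj l1.
have {P2 l2} := P2 n s t hst disj l2.
set S2 := \sum_i _; set S1 := \sum_i _ => h2 h1.
have S0 : 0 <= S1 + S2 by rewrite addr_ge0// sumr_ge0.
apply: (@le_lt_trans _ _ (`|K| * (S1 + S2))).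
  rewrite -big_split mulr_sumr; apply: ler_sum => i _ /=.
  have [as_ [st tb]] := hst i.
  apply: (le_trans (H _ _ as_ st tb)).
  by rewrite ler_wpM2r ?addr_ge0// ler_norm.
have -> : e = (`|K| + 1) * (e' + e').
  by rewrite /e'; field; rewrite gt_eqF.
apply: (@le_lt_trans _ _ ((`|K| + 1) * (S1 + S2))).
  by rewrite ler_wpM2r// lerDl.
by rewrite ltr_pM2l// ltrD.
Qed.

Lemma abs_cont_id (R : realType) (a b : R) : abs_cont a b id.
Proof.
move=> e e0; exists e => // n s t hst _; apply: le_lt_trans.
by apply: ler_sum => i _; rewrite ger0_norm// subr_ge0; have [_ []] := hst i.
Qed.

Lemma abs_cont_lipschitz (R : realType) (a b K : R) (p : R -> R) :
  (forall s t, a <= s -> s <= t -> t <= b -> `|p t - p s| <= K * (t - s)) ->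
  abs_cont a b p.
Proof.
move=> H; apply: (@abs_cont_dom _ a b (`|K|) id id); try exact: abs_cont_id.
move=> s t as_ st tb; apply: (le_trans (H _ _ as_ st tb)).
have ts : 0 <= t - s by rewrite subr_ge0.
rewrite /= (ger0_norm ts) mulrDr.
have := ler_norm K; have := normr_ge0 K; set A := `|K|; nra.
Qed.

Lemma abs_cont_cst (R : realType) (a b c : R) : abs_cont a b (fun=> c).
Proof.
by apply: (@abs_cont_lipschitz _ _ _ 0) => s t *; rewrite subrr normr0 mul0r.
Qed.

Lemma abs_contD (R : realType) (a b : R) (g1 g2 : R -> R) :
  abs_cont a b g1 -> abs_cont a b g2 -> abs_cont a b (fun t => g1 t + g2 t).
Proof.
move=> ac1 ac2; apply: (abs_cont_dom (K := 1) ac1 ac2) => s t _ _ _.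
by rewrite mul1r opprD addrACA ler_normD.
Qed.

Lemma abs_contS (R : realType) (a b a' b' : R) (g : R -> R) :
  a <= a' -> b' <= b -> abs_cont a b g -> abs_cont a' b' g.
Proof.
move=> aa bb ac e /ac[d d0 dP]; exists d => // n s t hst; apply: dP => i.
by have [? [? ?]] := hst i; split; [|split] => //; lra.
Qed.

Lemma abs_cont_dist (R : realType) (a b : R) (g : R -> R) :
  abs_cont a b g -> forall e, 0 < e -> exists2 d : R, 0 < d &
    forall s t, a <= s -> s <= t -> t <= b -> t - s < d -> `|g t - g s| < e.
Proof.
move=> ac e /ac[d d0 dP]; exists d => // s t as_ st tb std.
have := dP 1%N (fun=> s) (fun=> t); rewrite !big_ord1; apply=> //.
by move=> i j; rewrite !ord1 eqxx.
Qed.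

Lemma abs_cont_within (R : realType) (a b : R) (g : R -> R) :
  abs_cont a b g -> {within `[a, b], continuous g}.
Proof.
move=> /abs_cont_dist ac.
apply/subspace_continuousP => x; rewrite /= in_itv/= => /andP[ax xb].
apply/cvgrPdist_lt => e /ac[d d0 dP].
rewrite near_withinE; near=> y; rewrite /= in_itv/= => /andP[ay yb].
have xy : `|x - y| < d by near: y; apply: cvgr_dist_lt.
have [lxy|/ltW lyx] := leP x y.
  by rewrite distrC; apply: dP => //; move: xy; rewrite ler0_norm; lra.
by apply: dP => //; move: xy; rewrite ger0_norm; lra.
Unshelve. all: by end_near. Qed.

Lemma abs_cont_bounded (R : realType) (a b : R) (g : R -> R) :
  abs_cont a b g -> exists2 M : R, 0 <= M &
    forall t, a <= t -> t <= b -> `|g t| <= M.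
Proof.
move=> ac; have [ab|ba] := leP a b; last first.
  by exists 0 => // t at_ tb; lra.
have [|c cab cP] := @EVT_max R (fun t => `|g t|) a b ab.
  move=> x; apply: (@continuous_comp _ _ _ (g : subspace `[a, b] -> R) Num.norm).
    exact: abs_cont_within.
  exact: norm_continuous.
by exists `|g c| => // t at_ tb; apply: cP; rewrite in_itv/= at_.
Qed.

Lemma abs_contM (R : realType) (a b : R) (g1 g2 : R -> R) :
  abs_cont a b g1 -> abs_cont a b g2 -> abs_cont a b (fun t => g1 t * g2 t).
Proof.
move=> ac1 ac2; have [M1 M10 h1] := abs_cont_bounded ac1.
have [M2 M20 h2] := abs_cont_bounded ac2.
apply: (abs_cont_dom (K := M1 + M2) ac1 ac2) => s t as_ st tb.
have -> : g1 t * g2 t - g1 s * g2 s =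
  g1 t * (g2 t - g2 s) + (g1 t - g1 s) * g2 s by ring.
apply: (le_trans (ler_normD _ _)); rewrite !normrM.
have H1 : `|g1 t| <= M1 by apply: h1; lra.
have H2 : `|g2 s| <= M2 by apply: h2; lra.
have := normr_ge0 (g1 t - g1 s); have := normr_ge0 (g2 t - g2 s).
have := normr_ge0 (g1 t); have := normr_ge0 (g2 s).
set A := `|g1 t - g1 s|; set B := `|g2 t - g2 s|.
move: H1 H2; set C := `|g1 t|; set D := `|g2 s|; nra.
Qed.

Lemma abs_cont_const (R : realType) (a b : R) (p : R -> R) :
  abs_cont a b p ->
  {ae @lebesgue_measure R, forall t, a <= t <= b ->
     derivable p t 1 /\ derive1 p t = 0} ->
  forall t, a <= t -> t <= b -> p t = p a.
Proof.
move=> ac ae0 t at_ tb; have act := abs_contS (lexx a) tb ac.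
apply/eqP; rewrite eq_le; apply/andP; split.
  apply: (abs_cont_le at_ act); apply: (lebesgue_aeS _ ae0) => s H /andP[as_ st].
  by have [|? ->] := H; rewrite ?as_ ?(le_trans st tb).
rewrite -lerN2; apply: (abs_cont_le (p := fun t => - p t) at_).
  by apply: (abs_cont_dom (K := 1) act act) => x y _ _ _;
    rewrite mul1r -opprD normrN lerDl.
apply: (lebesgue_aeS _ ae0) => s H /andP[as_ st].
have [|ds ds0] := H; first by rewrite as_ (le_trans st tb).
split; first exact: derivableN.
by rewrite derive1E deriveN// -derive1E ds0 oppr0.
Qed.

(** * Arc length of admissible curves *)

Lemma lebesgue_ae_neq (R : realType) (a : R) :
  {ae @lebesgue_measure R, forall t, t <> a}.
Proof.
exists [set a]; split; first exact: measurable_set1.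
  exact: lebesgue_measure_set1.
by move=> t /= /contrapT.
Qed.

(** Absolute continuity of [F] is that of the Lebesgue integral, tested on the union of the given
    intervals. Cutting [s] off outside [[0, T]] makes it integrable on every interval, as the
    differentiation theorem asks. *)
Lemma indefinite_integral (R : realType) (T : R) (s : R -> R) :
  0 <= T -> (forall t, 0 <= s t) ->
  (@lebesgue_measure R).-integrable `[0, T] (EFin \o s) ->
  exists F : R -> R, [/\ abs_cont 0 T F, F 0 = 0,
    (forall t t', 0 <= t -> t <= t' -> t' <= T -> F t <= F t'),
    (F T)%:E = (\int[@lebesgue_measure R]_(t in `[0%R, T]) (s t)%:E)%E &
    {ae @lebesgue_measure R, forall t, 0 <= t <= T ->
       derivable F t 1 /\ derive1 F t = s t}].
Proof.
move=> T0 s0 ints.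
pose mu := @lebesgue_measure R.
pose r := s \_ `[0, T].
have r0 t : 0 <= r t by rewrite /r patchE; case: ifP.
have intrT : mu.-integrable setT (EFin \o r).
  by rewrite /r -restrict_EFin; apply/integrable_restrict => //=; rewrite setTI.
have intr (A : set R) : measurable A -> mu.-integrable A (EFin \o r).
  by move=> mA; exact: integrableS intrT.
pose F x := (\int[mu]_(t in [set` Interval (BLeft 0) (BRight x)]) (r t))%R.
have FB t t' : 0 <= t -> t <= t' ->
  F t' - F t = (\int[mu]_(u in `]t, t']) (r u))%R.
  move=> t0 tt'; rewrite /F Rintegral_itvB//; first exact: intr.
have Fint (A : set R) : measurable A ->
    ((\int[mu]_(u in A) r u)%R%:E = \int[mu]_(u in A) (r u)%:E)%E.
  by move=> mA; rewrite /Rintegral fineK// integrable_fin_num//; exact: intr.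
exists F; split.
- move=> e e0; have [d [d0 dP]] := integral_normr_continuous intrT e0.
  exists d => // n a b hab disj hsum.
  pose I i := `]a i, b i]%classic.
  have mI i : measurable (I i) by exact: measurable_itv.
  have tI : trivIset setT I.
    apply/trivIsetP => i j _ _ ij; rewrite -subset0 => x [].
    rewrite /I /= !in_itv/= => /andP[ax xb] /andP[ax' xb'].
    by have [h|h] := disj i j ij; lra.
  have mU : measurable (\big[setU/set0]_(i < n) I i) by exact: bigsetU_measurable.
  have muU : mu (\big[setU/set0]_(i < n) I i) = (\sum_(i < n) (b i - a i))%:E.
    transitivity (\sum_(i < n) mu (I i))%E; first exact: measure_semi_additive_ord.
    rewrite -sumEFin; apply: eq_bigr => i _.
    rewrite /mu /I lebesgue_measure_itv/= lte_fin; have [_ [abi _]] := hab i.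
    case: ltP => [//|bai]; have -> : a i = b i by apply/le_anti/andP.
    by rewrite subrr.
  have lt_d : (mu (\big[setU/set0]_(i < n) I i) < d%:E)%E by rewrite muU lte_fin.
  have := dP _ mU lt_d.
  apply: le_lt_trans; rewrite -lee_fin.
  under [in leRHS]eq_Rintegral do rewrite (ger0_norm (r0 _)).
  rewrite Fint// ge0_integral_bigsetU//=.
  + rewrite -sumEFin; apply: lee_sum => i _.
    have [ai [abi _]] := hab i.
    rewrite FB// ger0_norm ?Rintegral_ge0// Fint//.
  + exact: index_enum_uniq.
  + by move: tI; apply: sub_trivIset.
  + exact: (measurable_int _ (intr _ mU)).
  + by move=> x _; rewrite lee_fin.
- have -> : F 0 = (\int[mu]_(t in [set 0%R]) (r t))%R by rewrite -set_itv1.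
  by rewrite /Rintegral integral_set1.
- move=> t t' t0 tt' _; rewrite -subr_ge0 FB//; exact: Rintegral_ge0.
- rewrite /F Fint//; apply: eq_integral => x xT; rewrite /r patchE.
  by rewrite xT.
- have := @FTC1 R r (BLeft 0) (fun y => intr _ (measurable_itv _))
    (integrable_locally (measurable_itv _) ints).
  apply: lebesgue_aeS2 (lebesgue_ae_neq 0) => t t_neq0 H /andP[t0 tT].
  have [|dF ->] := H.
    by rewrite lte_fin lt_neqAle t0 andbT eq_sym; apply/eqP.
  split=> //; rewrite /r patchE mem_set//=.
  by rewrite in_itv/= t0.
Qed.

(** The integral of a nonnegative function is a supremum over simple functions below it, so
    comparison needs no measurability of [g] or [h]. This is what allows [speed] as the larger
    integrand. *)
Lemma ge0_integral_subset d (T : measurableType d) (R : realType)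
    (mu : {measure set T -> \bar R}) (D E : set T) (g h : T -> \bar R) :
  D `<=` E -> (forall x, D x -> g x = h x) ->
  (forall x, E x -> (0 <= h x)%E) ->
  (\int[mu]_(x in D) g x <= \int[mu]_(x in E) h x)%E.
Proof.
move=> DE gh h0.
have g0 x : D x -> (0 <= g x)%E by move=> Dx; rewrite gh//; apply/h0/DE.
rewrite !ge0_integralE//; apply: le_ereal_sup => _ [k /= hk <-].
exists k => //= x; apply: (le_trans (hk x)); rewrite !patchE.
case: ifPn => [|_]; rewrite ?inE.
  by move=> Dx; rewrite mem_set ?gh//; exact: DE.
by case: ifPn => //; rewrite inE; exact: h0.
Qed.

(** [f] is unconstrained on negative numbers; composing with the norm gives a function continuous on
    the whole line, which composes without side conditions. *)
Lemma f_normr_continuous (R : realType) (f : R -> R) :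
  in_frakF f -> continuous (fun r : R => f `|r|).
Proof.
move=> [[cf _] _] r.
move/subspace_continuousP : cf => /(_ `|r|).
rewrite /= in_itv/= andbT => /(_ (normr_ge0 _)) cfr.
apply/cvgrPdist_lt => e e0.
move/cvgrPdist_lt : cfr => /(_ _ e0); rewrite near_withinE => hA.
have /nbhs_ballP[d /= d0 dP] := hA.
apply/nbhs_ballP; exists d => // x rx; apply: dP; last first.
  by rewrite /= in_itv/= andbT.
exact: le_lt_trans (ler_dist_dist _ _) rx.
Qed.

Lemma cauchy_schwarz3 (R : realType) (a b c x y z N s : R) :
  0 <= N -> 0 <= s -> a ^+ 2 + b ^+ 2 + c ^+ 2 <= N ^+ 2 ->
  x ^+ 2 + y ^+ 2 + z ^+ 2 <= s ^+ 2 -> a * x + b * y + c * z <= N * s.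
Proof.
move=> N0 s0 hN hs.
have [h|h] := leP (a * x + b * y + c * z) 0.
  by rewrite (le_trans h)// mulr_ge0.
rewrite -(@ler_pXn2r _ 2) ?nnegrE ?mulr_ge0// ?(ltW h)//.
have : (a * x + b * y + c * z) ^+ 2 <=
  (a ^+ 2 + b ^+ 2 + c ^+ 2) * (x ^+ 2 + y ^+ 2 + z ^+ 2).
  (* Lagrange's identity. *)
  rewrite -subr_ge0 (_ : _ - _ = (a * y - b * x) ^+ 2 + (a * z - c * x) ^+ 2
    + (b * z - c * y) ^+ 2); last by ring.
  by rewrite !addr_ge0// sqr_ge0.
move=> /le_trans; apply; rewrite exprMn.
by apply: ler_pM => //; rewrite !addr_ge0// sqr_ge0.
Qed.

Lemma rad_ge0 (R : realType) (x y : R -> R) t : 0 <= rad x y t.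
Proof. exact: sqrtr_ge0. Qed.

Lemma frakF_ge0 (R : realType) (f : R -> R) r : in_frakF f -> 0 <= r -> 0 <= f r.
Proof.
move=> [[_ [f0 fpos]] _]; rewrite le_eqVlt => /predU1P[<-|/fpos/ltW//].
by rewrite f0.
Qed.

Lemma integrable_sqr (R : realType) (T : R) (u : R -> R) : L2 T u ->
  (@lebesgue_measure R).-integrable `[0, T] (fun t => (u t ^+ 2)%:E).
Proof.
move=> [mu_ fu]; apply/integrableP; split.
  by apply/measurable_EFinP; exact: measurable_funX.
by under eq_integral do rewrite gee0_abs ?lee_fin ?sqr_ge0//.
Qed.

(* Dual form of [F' >= speed]: <p, gamma'> <= N F' whenever 2 H(gamma, p) <= N^2. *)
Definition arc_majorant (R : realType) (f : R -> R) (T : R) (x y z F : R -> R) :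
    Prop :=
  {ae @lebesgue_measure R, forall t, 0 <= t <= T ->
    [/\ derivable x t 1, derivable y t 1, derivable z t 1, derivable F t 1 &
     0 <= derive1 F t /\
     forall p1 p2 p3 N, 0 <= N ->
       p1 ^+ 2 + p2 ^+ 2 + p3 ^+ 2 * f (rad x y t) ^+ 2 <= N ^+ 2 ->
       p1 * derive1 x t + p2 * derive1 y t + p3 * derive1 z t <=
       N * derive1 F t]}.

(** [F] is the primitive of the norm of the control, which the square integrability of the controls
    makes integrable. An inequality between [F T] and [length] suffices for bounding lengths from
    below. *)
Lemma arc_length (R : realType) (f : R -> R) (T : R) (x y z : R -> R) :
  in_frakF f -> admissible f T x y z ->
  exists F : R -> R, [/\ abs_cont 0 T F, F 0 = 0,
    (forall t t', 0 <= t -> t <= t' -> t' <= T -> F t <= F t'),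
    ((F T)%:E <= length f T x y z)%E &
    arc_majorant f T x y z F].
Proof.
move=> fF [T0 [acx [acy [acz [u1 [u2 [u3 [L1 [L2_ [L3 ae_xyz]]]]]]]]]].
pose mu := @lebesgue_measure R.
pose h t := f (rad x y t).
(* On the axis [u3] does not move the curve, and the convention 0 / 0 = 0 makes [speed] ignore it.
   It is erased there, otherwise [F] could exceed the length. *)
pose v t := if h t == 0 then 0 else u3 t.
pose s t := Num.sqrt (u1 t ^+ 2 + u2 t ^+ 2 + v t ^+ 2).
have mT : measurable (`[0, T] : set R) by exact: measurable_itv.
have mac g : abs_cont 0 T g -> measurable_fun `[0, T] g.
  by move=> /abs_cont_within; exact: subspace_continuous_measurable_fun.
have msqrt : measurable_fun setT (@Num.sqrt R).
  by apply: continuous_measurable_fun; exact: sqrt_continuous.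
have mh : measurable_fun `[0, T] h.
  have -> : h = (fun r : R => f `|r|) \o rad x y.
    by apply/funext => t; rewrite /h /= ger0_norm ?rad_ge0.
  apply: measurableT_comp.
    by apply: continuous_measurable_fun; exact: f_normr_continuous.
  apply: measurableT_comp => //.
  by apply: measurable_funD; apply: measurable_funX; exact: mac.
have mv : measurable_fun `[0, T] v.
  apply: measurable_fun_if => //.
  - by apply: measurable_fun_eqr.
  - by apply: measurable_funS L3.1 => // t [].
have ms : measurable_fun `[0, T] s.
  apply: measurableT_comp => //.
  apply: measurable_funD; [apply: measurable_funD|]; apply: measurable_funX => //.
    exact: L1.1.
  exact: L2_.1.
have sE t : s t ^+ 2 = u1 t ^+ 2 + u2 t ^+ 2 + v t ^+ 2.
  by rewrite sqr_sqrtr// !addr_ge0// sqr_ge0.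
have s0 t : 0 <= s t by exact: sqrtr_ge0.
have ints : mu.-integrable `[0, T] (EFin \o s).
  (* Dominating function: s <= 1 + s^2. *)
  pose g t := ((1 + (u1 t ^+ 2 + u2 t ^+ 2 + u3 t ^+ 2))%:E).
  have intg : mu.-integrable `[0, T] g.
    have -> : g = fun t => (1%:E + ((u1 t ^+ 2)%:E + (u2 t ^+ 2)%:E + (u3 t ^+ 2)%:E))%E.
      by apply/funext => t; rewrite /g !EFinD.
    apply: integrableD => //.
      apply/integrableP; split; first exact: measurable_cst.
      rewrite integral_cst//= normr1 mul1e lebesgue_measure_itv/=.
      by case: ifP; rewrite ?ltry.
    by do 2?[apply: integrableD => //]; exact: integrable_sqr.
  apply: le_integrable intg => //; first exact/measurable_EFinP.
  move=> t _; rewrite /g /= !ger0_norm//; last first.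
    by rewrite !addr_ge0// sqr_ge0.
  rewrite lee_fin.
  have : v t ^+ 2 <= u3 t ^+ 2.
    by rewrite /v; case: ifP => // _; rewrite expr0n/= sqr_ge0.
  have := sE t; have := sqr_ge0 (s t - 1); have := sqr_ge0 (s t).
  by move: (u1 t ^+ 2) (u2 t ^+ 2) (v t ^+ 2) (u3 t ^+ 2) => *; nra.
have [F [acF F0 ndF FT aeF]] := indefinite_integral T0 s0 ints.
exists F; split=> //.
- rewrite FT.
  have [N [mN N0 HN]] := ae_xyz.
  rewrite (ge0_negligible_integral mN)//; last 2 first.
    exact/measurable_EFinP.
    by move=> t _; rewrite lee_fin.
  (* [s] and [speed] are known to agree only outside the null set [N], so [N] is first removed on
     the left and then put back on the right by monotonicity. *)
  rewrite /length; apply: ge0_integral_subset => //.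
    move=> t [/=]; rewrite in_itv/= => t0T nNt.
    have /(_ t0T)[_ [_ [_ [xE [yE zE]]]]] := contrapT (fun hn => nNt (HN t hn)).
    rewrite /speed xE yE zE; congr (EFin (Num.sqrt (_ + _))).
    rewrite /v -/(h t); case: ifPn => [/eqP ->|h0].
      by rewrite mulr0 expr0n/= mul0r.
    by rewrite exprMn mulfK// expf_eq0.
  by move=> t _; rewrite lee_fin sqrtr_ge0.
- rewrite /arc_majorant; apply: lebesgue_aeS2 aeF ae_xyz => t HF H t0T.
  have [dF FE] := HF t0T.
  have [dx [dy [dz [xE [yE zE]]]]] := H t0T.
  split=> //; rewrite FE; split=> // p1 p2 p3 N N0 hN.
  have -> : p3 * derive1 z t = p3 * h t * v t.
    by rewrite zE /v -/(h t); case: ifPn => [/eqP ->|_]; rewrite -/(h t); ring.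
  by apply: cauchy_schwarz3 => //; rewrite ?sE ?exprMn ?xE ?yE.
Qed.

(** * Abnormal minimizers *)

Lemma is_derive1D (R : realType) (p q : R -> R) (t a b : R) :
  is_derive t 1 p a -> is_derive t 1 q b ->
  is_derive t 1 (fun s => p s + q s) (a + b).
Proof. by move=> hp hq; exact: is_deriveD. Qed.

Lemma is_derive1M (R : realType) (p q : R -> R) (t a b : R) :
  is_derive t 1 p a -> is_derive t 1 q b ->
  is_derive t 1 (fun s => p s * q s) (a * q t + p t * b).
Proof.
move=> hp hq.
have h : is_derive t 1 (fun s => p s * q s) _ := is_deriveM hp hq.
by apply: is_derive_eq h _; rewrite /GRing.scale/=; ring.
Qed.

Lemma is_derive1_derivable (R : realType) (p : R -> R) (t d : R) :
  is_derive t 1 p d <-> derivable p t 1 /\ derive1 p t = d.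
Proof.
split=> [h|[h <-]].
  split; first exact: (@ex_derive _ _ _ _ _ _ _ h).
  by rewrite derive1E (@derive_val _ _ _ _ _ _ _ h).
by rewrite derive1E; exact: derivableP.
Qed.

Lemma derivable_cts (R : realType) (p : R -> R) (t : R) :
  derivable p t 1 -> {for t, continuous p}.
Proof. by move=> /derivable1_diffP/differentiable_continuous. Qed.

Lemma lebesgue_ae_exists (R : realType) (a b : R) (P : R -> Prop) :
  a < b -> {ae @lebesgue_measure R, forall t, P t} ->
  exists2 t, a < t < b & P t.
Proof.
move=> ab [N [mN N0 HN]].
apply: contrapT => H.
have : (@lebesgue_measure R `]a, b[%classic <= @lebesgue_measure R N)%E.
  apply: le_measure; [by rewrite inE|by rewrite inE|].
  move=> t; rewrite /= in_itv/= => tab.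
  by apply: (HN t) => /= Pt; apply: H; exists t.
rewrite lebesgue_measure_itv/= lte_fin ab [X in (_ <= X)%E]N0.
by rewrite -EFinB lee_fin subr_le0 leNgt ab.
Qed.

Lemma sqrt_sum3_eq0 (R : realType) (a b c : R) :
  0 <= a -> 0 <= b -> 0 <= c -> Num.sqrt (a + b + c) = 0 ->
  [/\ a = 0, b = 0 & c = 0].
Proof.
move=> a0 b0 c0 /eqP; rewrite sqrtr_eq0 => h.
by split; apply/eqP; lra.
Qed.

Lemma no_abnormal_minimizer (R : realType) (f : R -> R) (T : R)
    (x y z : R -> R) :
  in_frakF f -> admissible f T x y z -> constant_speed f T x y z ->
  nonconstant T x y z -> ~ abnormal_lift f T x y z.
Proof.
move=> [[_ [f0 fpos]] _] [T0 [acx [acy [acz [u1 [u2 [u3 [_ [_ [_ ae_xyz]]]]]]]]]].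
move=> [c ae_c] [t1 [/andP[t10 t1T] Ht1]].
move=> [lu [lv [lw [_ [_ [acw [[t0 [/andP[t00 t0T] Ht0]] H0]]]]]]].
have Tpos : 0 < T.
  rewrite lt_neqAle T0 andbT; apply/eqP => T_0.
  by apply: Ht1; have -> : t1 = 0 by lra.
have HH t : 0 <= t <= T -> [/\ lu t = 0, lv t = 0 & f (rad x y t) * lw t = 0].
  move=> /H0/eqP; rewrite /Ham -/(rad x y t) mulf_eq0 invr_eq0 pnatr_eq0/=.
  rewrite -exprMn => /eqP h.
  have a1 := sqr_ge0 (lu t); have a2 := sqr_ge0 (lv t).
  have a3 := sqr_ge0 (f (rad x y t) * lw t).
  by split; apply/eqP; rewrite -sqrf_eq0; apply/eqP; lra.
(* The Hamiltonian already kills [lu] and [lv], so a nonzero covector has [lw] nonzero; by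
   continuity this persists near [t0] and forces f(r) = 0 there. *)
have lw0 : 0 < `|lw t0|.
  rewrite normr_gt0; apply/eqP => lw0; apply: Ht0.
  by have [|-> ->] := HH t0; rewrite ?t00.
have [d d0 dP] := abs_cont_dist acw lw0.
have xy0 t : Num.max 0 (t0 - d) < t < Num.min T (t0 + d) -> x t = 0 /\ y t = 0.
  rewrite gt_max lt_min => /andP[/andP[tpos tl] /andP[tT tr]].
  have lwt : lw t != 0.
    apply/eqP => lwt.
    have [h|/ltW h] := leP t0 t.
      by have := dP t0 t t00 h (ltW tT); rewrite lwt sub0r normrN ltxx => /(_ _); lra.
    by have := dP t t0 (ltW tpos) h t0T; rewrite lwt subr0 ltxx => /(_ _); lra.
  have [|_ _ /eqP] := HH t; first by rewrite (ltW tpos) (ltW tT).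
  rewrite mulf_eq0 (negbTE lwt) orbF => /eqP frad.
  have : rad x y t <= 0.
    by rewrite leNgt; apply/negP => /fpos; rewrite frad ltxx.
  rewrite le_eqVlt ltNge sqrtr_ge0 orbF sqrtr_eq0 => h.
  have := sqr_ge0 (x t); have := sqr_ge0 (y t) => hy hx.
  by split; apply/eqP; rewrite -sqrf_eq0; apply/eqP; lra.
(* The window is a nondegenerate open interval even if [t0] is an endpoint of [[0, T]]. It thus has
   positive measure and meets the set where both almost-everywhere properties hold. *)
have ab : Num.max 0 (t0 - d) < Num.min T (t0 + d).
  by rewrite gt_max !lt_min Tpos/=; apply/andP; split; [|apply/andP; split]; lra.
have der0 (g : R -> R) t :
    (forall s, Num.max 0 (t0 - d) < s < Num.min T (t0 + d) -> g s = 0) ->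
    Num.max 0 (t0 - d) < t < Num.min T (t0 + d) -> derive1 g t = 0.
  move=> g0 tab; rewrite derive1E.
  apply/(@derive_val _ _ _ t 1 g)/(near_eq_is_derive (f := cst 0)).
  have : t \in `](Num.max 0 (t0 - d)), (Num.min T (t0 + d))[ by rewrite in_itv.
  move/near_in_itvoo; apply: filterS => s; rewrite in_itv/= => sab.
  by rewrite g0.
have c0 : c = 0.
  have [t tab [h1 h2]] := lebesgue_ae_exists ab
    (lebesgue_aeS2 (fun t => @conj _ _) ae_xyz ae_c).
  move: (tab); rewrite gt_max lt_min => /andP[/andP[tpos tl] /andP[tT tr]].
  have tT' : 0 <= t <= T by rewrite !ltW.
  rewrite -(h2 tT'); have [_ [_ [_ [_ [_ zE]]]]] := h1 tT'.
  have [xt yt] := xy0 t tab.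
  rewrite /speed zE (@der0 x) 1?(@der0 y)//; last 2 first.
    by move=> s /xy0[].
    by move=> s /xy0[].
  rewrite /rad xt yt expr0n/= addr0 sqrtr0 f0 mulr0 expr0n/= mul0r.
  by rewrite addr0 sqrtr0.
have ae0 : {ae @lebesgue_measure R, forall t, 0 <= t <= T ->
  [/\ is_derive t 1 x 0, is_derive t 1 y 0 & is_derive t 1 z 0]}.
  apply: lebesgue_aeS2 ae_c ae_xyz => t hc hxyz tT.
  have [dx [dy [dz [_ [_ zE]]]]] := hxyz tT.
  have := hc tT; rewrite c0 => /sqrt_sum3_eq0[].
  - exact: sqr_ge0.
  - exact: sqr_ge0.
  - by rewrite divr_ge0// sqr_ge0.
  move=> /eqP; rewrite sqrf_eq0 => /eqP x0 /eqP; rewrite sqrf_eq0 => /eqP y0.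
  (* Zero speed leaves two cases: z' = 0, or f(r) = 0, where the quotient vanishes by convention; in
     the latter, admissibility gives z' = u3 f(r) = 0. *)
  move=> /eqP; rewrite mulf_eq0 invr_eq0 !sqrf_eq0 => z0.
  split; apply/is_derive1_derivable; split=> //.
  by case/orP: z0 => /eqP // fr; rewrite zE fr mulr0.
apply: Ht1; split; [|split].
- apply: (abs_cont_const acx) => //; apply: (lebesgue_aeS _ ae0) => t h tT.
  by have [/is_derive1_derivable] := h tT.
- apply: (abs_cont_const acy) => //; apply: (lebesgue_aeS _ ae0) => t h tT.
  by have [_ /is_derive1_derivable] := h tT.
- apply: (abs_cont_const acz) => //; apply: (lebesgue_aeS _ ae0) => t h tT.
  by have [_ _ /is_derive1_derivable] := h tT.
Qed.

(** * Calculus on an interval *)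

Lemma within_contD (R : realType) (A : set R) (p q : R -> R) :
  {within A, continuous p} -> {within A, continuous q} ->
  {within A, continuous (fun t => p t + q t)}.
Proof.
move=> cp cq; have -> : (fun t => p t + q t) = (p + q)%R by [].
by move=> t; apply: continuousD; [exact: cp|exact: cq].
Qed.

Lemma within_contM (R : realType) (A : set R) (p q : R -> R) :
  {within A, continuous p} -> {within A, continuous q} ->
  {within A, continuous (fun t => p t * q t)}.
Proof.
move=> cp cq; have -> : (fun t => p t * q t) = (p * q)%R by [].
by move=> t; apply: continuousM; [exact: cp|exact: cq].
Qed.

Lemma within_cont_comp (R : realType) (A : set R) (p q : R -> R) :
  {within A, continuous p} -> continuous q ->
  {within A, continuous (fun t => q (p t))}.
Proof.
move=> cp cq t; apply: (@continuous_comp _ _ _ (p : subspace A -> R) q).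
  exact: cp.
exact: cq.
Qed.

Lemma within_itvP (R : realType) (a b : R) (g : R -> R) :
  {within `[a, b], continuous g} <->
  forall s, a <= s <= b -> forall e, 0 < e -> exists2 d : R, 0 < d &
    forall r, a <= r <= b -> `|s - r| < d -> `|g s - g r| < e.
Proof.
split.
  move=> /subspace_continuousP cg s sab e e0.
  have := cg s; rewrite /= in_itv/= => /(_ sab) /cvgrPdist_lt/(_ _ e0).
  rewrite near_withinE => /nbhs_ballP[d /= d0 dP].
  by exists d => // r rab srd; apply: dP => //=; rewrite in_itv.
move=> H; apply/subspace_continuousP => s; rewrite /= in_itv/= => sab.
apply/cvgrPdist_lt => e e0; have [d d0 dP] := H s sab e e0.
rewrite near_withinE; apply/nbhs_ballP; exists d => // r /= srd.
by rewrite in_itv/= => rab; exact: dP.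
Qed.

Lemma within_shift (R : realType) (a T e : R) (g : R -> R) :
  0 <= a -> a + e <= T -> {within `[0, T], continuous g} ->
  {within `[0, e], continuous (fun s => g (a + s))}.
Proof.
move=> a0 aT /within_itvP H; apply/within_itvP => s /andP[s0 se] eps eps0.
have [|d d0 dP] := H (a + s) _ eps eps0; first by apply/andP; split; lra.
exists d => // r /andP[r0 re] srd; apply: dP; first by apply/andP; split; lra.
by rewrite opprD addrACA subrr add0r.
Qed.

Lemma is_derive1_shift (R : realType) (p : R -> R) (a t d : R) :
  is_derive (a + t) 1 p d -> is_derive t 1 (fun s => p (a + s)) d.
Proof.
move=> h; have h1 : is_derive t 1 (fun s : R => a + s) (0 + 1).
  exact: is_derive1D (is_derive_cst _ _ _) (is_derive_id _ _).
have := @is_derive1_comp _ p (fun s => a + s) t _ _ h h1.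
by rewrite add0r mulr1.
Qed.

Lemma is_derive1P (R : realType) (p : R -> R) (t d : R) :
  is_derive t 1 p d <-> forall e, 0 < e -> exists2 r : R, 0 < r &
    forall s, `|s - t| < r -> `|p s - p t - d * (s - t)| <= e * `|s - t|.
Proof.
split.
  move=> /is_derive1_derivable[/cvg_ex[l hl]].
  have ll : l = derive1 p t by rewrite derive1E; apply/esym/cvg_lim.
  move: hl; rewrite {}ll => + pd; rewrite pd => /cvgrPdist_lt hl e e0.
  have [r /= r0 rP] := hl _ e0.
  exists r => // s st; have [->|nst] := eqVneq s t.
    by rewrite !subrr mulr0 !subr0 normr0 mulr0.
  have st0 : s - t != 0 by rewrite subr_eq0.
  have := rP (s - t); rewrite /= sub0r normrN => /(_ st st0).
  rewrite /GRing.scale/= mulr1 subrK => /ltW h.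
  have -> : p s - p t - d * (s - t) = - ((d - (s - t)^-1 * (p s - p t)) * (s - t)).
    by field.
  by rewrite normrN normrM ler_wpM2r.
move=> H.
suff hc : h^-1 *: ((p \o shift t) (h *: 1) - p t) @[h --> 0^'] --> d.
  apply/is_derive1_derivable; split; first by apply/cvg_ex; exists d.
  by rewrite derive1E; exact: cvg_lim.
apply/cvgrPdist_le => e e0; have [r r0 rP] := H e e0.
exists r => // h /=; rewrite sub0r normrN => hr h0.
have := rP (h + t); rewrite addrK => /(_ hr).
rewrite /GRing.scale/= mulr1 => hle.
have -> : d - h^-1 * (p (h + t) - p t) = - (h^-1 * (p (h + t) - p t - d * h)).
  by field.
by rewrite normrN normrM normfV ler_pdivrMl ?normr_gt0// [leRHS]mulrC.
Qed.

Lemma squeeze_derive0 (R : realType) (p q : R -> R) (t d : R) :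
  0 < d -> (forall s, `|s - t| < d -> `|p s| <= q s) -> q t = 0 ->
  is_derive t 1 q 0 -> is_derive t 1 p 0.
Proof.
move=> d0 pq qt /is_derive1P hq; apply/is_derive1P => e e0.
have pt : p t = 0.
  by apply/eqP; rewrite -normr_le0 -qt; apply: pq; rewrite subrr normr0.
have [r r0 rP] := hq e e0; exists (Num.min d r); first by rewrite lt_min d0.
move=> s; rewrite lt_min => /andP[sd sr].
have := rP s sr; rewrite pt qt !mul0r !subr0; apply: le_trans.
by rewrite (le_trans (pq s sd))// ler_norm.
Qed.

Lemma lipschitz_of_derive (R : realType) (p : R -> R) (a b K : R) : a <= b ->
  {within `[a, b], continuous p} ->
  (forall t, a < t < b -> exists2 d, is_derive t 1 p d & `|d| <= K) ->
  `|p b - p a| <= K * (b - a).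
Proof.
rewrite le_eqVlt => /predU1P[<-|ab] cp dp.
  by rewrite !subrr normr0 mulr0.
have hd t : t \in `]a, b[ -> is_derive t 1 p (derive1 p t).
  rewrite in_itv/= => /dp[d /is_derive1_derivable[dp' _] _].
  by apply/is_derive1_derivable.
have [c cab ->] := MVT ab hd cp.
move: cab; rewrite in_itv/= => cab.
have [d hc dK] := dp c cab.
have ba : 0 < b - a by rewrite subr_gt0.
have /is_derive1_derivable[_ ->] := hc.
by rewrite normrM (gtr0_norm ba) ler_pM2r.
Qed.

Lemma const_of_derive (R : realType) (p : R -> R) (T : R) :
  {within `[0, T], continuous p} ->
  (forall t, 0 < t < T -> is_derive t 1 p 0) ->
  forall t, 0 <= t <= T -> p t = p 0.
Proof.
move=> cp dp t /andP[t0 tT].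
have : `|p t - p 0| <= 0 * (t - 0).
  apply: lipschitz_of_derive => //.
    apply: continuous_subspaceW cp => s; rewrite /= !in_itv/= => /andP[-> st].
    exact: le_trans tT.
  move=> s /andP[s0 st]; exists 0; last by rewrite normr0.
  by apply: dp; rewrite s0 (lt_le_trans st).
by rewrite mul0r normr_le0 subr_eq0 => /eqP.
Qed.

(** * The normal flow *)

Lemma frakF_derive (R : realType) (f : R -> R) (r : R) :
  in_frakF f -> 0 < r -> is_derive r 1 f (derive1 f r).
Proof.
by move=> [_ [df _]] /df[dfr _]; apply/is_derive1_derivable.
Qed.

(** By condition (iii) the derivative 2 f f' of f^2 is at most C s at s near 0, hence at most C r on
    (0, r); the mean value inequality supplies the second factor r. *)
Lemma frakF_sqr_bound (R : realType) (f : R -> R) : in_frakF f ->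
  exists C d, [/\ 0 <= C, 0 < d & forall r, 0 <= r < d -> f r ^+ 2 <= C * r ^+ 2].
Proof.
move=> fF; have [[cf [f0 _]] [_ [[L limL] _]]] := fF.
move/cvgrPdist_lt : limL => /(_ 1 ltr01) [d /= d0 dP].
have bnd r : 0 < r -> r < d -> `|f r * derive1 f r| <= (`|L| + 1) * r.
  move=> r0 rd; have := dP r; rewrite /= sub0r normrN gtr0_norm// => /(_ rd r0).
  move=> h; have : `|f r * derive1 f r / r| <= `|L| + 1.
    have -> : f r * derive1 f r / r = L - (L - f r * derive1 f r / r) by ring.
    by apply: (le_trans (ler_normB _ _)); rewrite lerD2l ltW.
  by rewrite normrM normfV (gtr0_norm r0) ler_pdivrMr.
exists (2 * (`|L| + 1)), d; split=> //.
move=> r /andP[]; rewrite le_eqVlt => /predU1P[<- _|r0 rd].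
  by rewrite f0 expr0n/= mulr0.
have : `|f r * f r - f 0 * f 0| <= 2 * (`|L| + 1) * r * (r - 0); last first.
  by rewrite f0 mulr0 !subr0 -!expr2 ger0_norm ?sqr_ge0// -mulrA -expr2.
apply: (@lipschitz_of_derive _ (fun s => f s * f s)); first exact: ltW.
  by apply: within_contM; apply: continuous_subspaceW cf => s;
    rewrite /= !in_itv/= => /andP[->].
move=> s /andP[s0 sr]; exists (derive1 f s * f s + f s * derive1 f s).
  by apply: is_derive1M; exact: frakF_derive.
have -> : derive1 f s * f s + f s * derive1 f s = 2 * (f s * derive1 f s) by ring.
rewrite normrM ger0_norm// -mulrA ler_wpM2l//.
apply: (le_trans (bnd s s0 (lt_trans sr rd))).
by rewrite ler_wpM2l ?addr_ge0// ltW.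
Qed.

Lemma rad_sqr (R : realType) (x y : R -> R) (t : R) :
  rad x y t ^+ 2 = x t ^+ 2 + y t ^+ 2.
Proof. by rewrite sqr_sqrtr// addr_ge0// sqr_ge0. Qed.

Lemma sqr_norm_derive (R : realType) (x y : R -> R) (t a b : R) :
  is_derive t 1 x a -> is_derive t 1 y b ->
  is_derive t 1 (fun s => x s ^+ 2 + y s ^+ 2) (2 * (x t * a + y t * b)).
Proof.
move=> hx hy; have h := is_derive1D (is_derive1M hx hx) (is_derive1M hy hy).
by apply: is_derive_eq h _; ring.
Qed.

(* At r = 0 the right-hand side is 0, since f 0 = 0. *)
Lemma f_rad_sqr_derive (R : realType) (f : R -> R) (x y : R -> R) (t a b : R) :
  in_frakF f -> is_derive t 1 x a -> is_derive t 1 y b ->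
  is_derive t 1 (fun s => f (rad x y s) ^+ 2)
    (2 * (f (rad x y t) * derive1 f (rad x y t) / rad x y t) * (x t * a + y t * b)).
Proof.
move=> fF hx hy; have hq := sqr_norm_derive hx hy.
have [r0|] := ltP 0 (rad x y t).
  have q0 : 0 < x t ^+ 2 + y t ^+ 2 by rewrite -rad_sqr exprn_gt0.
  have hr := @is_derive1_comp _ _ (fun s => x s ^+ 2 + y s ^+ 2) t _ _
    (is_derive1_sqrt q0) hq.
  have hf := @is_derive1_comp _ f (rad x y) t _ _ (frakF_derive fF r0) hr.
  have h := is_derive1M hf hf.
  apply: is_derive_eq h _; rewrite /= -/(rad x y t).
  by field; rewrite gt_eqF.
rewrite le_eqVlt ltNge sqrtr_ge0 orbF => /eqP r0.
have f0 : f 0 = 0 by case: fF => [[_ []]].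
have q0 : x t ^+ 2 + y t ^+ 2 = 0 by rewrite -rad_sqr r0 expr0n.
rewrite r0 f0 !mul0r mulr0 mul0r.
(* On the axis f(r)^2 lies between 0 and C (x^2 + y^2), whose derivative vanishes because x = y = 0
   there. *)
have [C [d [C0 d0 Cd]]] := frakF_sqr_bound fF.
have hC : is_derive t 1 (fun s => C * (x s ^+ 2 + y s ^+ 2)) 0.
  have h := is_derive1M (is_derive_cst C t 1) hq.
  apply: is_derive_eq h _; rewrite mul0r add0r.
  have [/eqP xt /eqP yt] : x t ^+ 2 == 0 /\ y t ^+ 2 == 0.
    have := sqr_ge0 (x t); have := sqr_ge0 (y t) => hy2 hx2.
    by split; apply/eqP; lra.
  move: xt yt => /eqP; rewrite sqrf_eq0 => /eqP -> /eqP; rewrite sqrf_eq0 => /eqP ->.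
  by rewrite !mul0r addr0 !mulr0.
have /is_derive1_derivable[/derivable_cts cq _] := hq.
have d2 : 0 < d ^+ 2 by rewrite exprn_gt0.
move/cvgrPdist_lt : cq => /(_ _ d2) /nbhs_ballP[e /= e0 eP].
apply: (squeeze_derive0 e0 _ _ hC); last by rewrite q0 mulr0.
move=> s st; rewrite ger0_norm ?sqr_ge0// -rad_sqr; apply: Cd.
rewrite sqrtr_ge0/= -(@ltr_pXn2r _ 2) ?nnegrE ?sqrtr_ge0 ?(ltW d0)//.
rewrite rad_sqr; have := eP s; rewrite /ball/= distrC => /(_ st).
by rewrite q0 sub0r normrN; apply: le_lt_trans; exact: ler_norm.
Qed.

(* Normal trajectories, with the constant momentum w as a parameter. *)
Record ham_flow (R : realType) (f : R -> R) (T w : R) (x y z u v : R -> R) :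
    Prop := HamFlow {
  ham_T : 0 < T;
  ham_cx : {within `[0, T], continuous x};
  ham_cy : {within `[0, T], continuous y};
  ham_cz : {within `[0, T], continuous z};
  ham_cu : {within `[0, T], continuous u};
  ham_cv : {within `[0, T], continuous v};
  ham_dx : forall t, 0 < t < T -> is_derive t 1 x (u t);
  ham_dy : forall t, 0 < t < T -> is_derive t 1 y (v t);
  ham_dz : forall t, 0 < t < T -> is_derive t 1 z (f (rad x y t) ^+ 2 * w);
  ham_du : forall t, 0 < t < T -> is_derive t 1 u
    (- (w ^+ 2 * (f (rad x y t) * derive1 f (rad x y t) / rad x y t) * x t));
  ham_dv : forall t, 0 < t < T -> is_derive t 1 v
    (- (w ^+ 2 * (f (rad x y t) * derive1 f (rad x y t) / rad x y t) * y t)) }.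

(** Twice the Hamiltonian along the curve; its constant value is the squared speed c^2. *)
Definition energy (R : realType) (f : R -> R) (w : R) (x y u v : R -> R) (t : R) :=
  u t ^+ 2 + v t ^+ 2 + w ^+ 2 * f (rad x y t) ^+ 2.

Section ham_flow.
Context (R : realType) (f : R -> R).
Hypothesis fF : in_frakF f.

Lemma normal_trajectory_flow T x y z : normal_trajectory f T x y z ->
  exists w u v, ham_flow f T w x y z u v.
Proof.
move=> [T0 [u [v [w [cx [cy [cz [cu [cv [cw H]]]]]]]]]].
have wE : forall t, 0 <= t <= T -> w t = w 0.
  apply: const_of_derive => // t /H[_ [_ [_ [_ [_ [dw [_ [_ [_ [_ [_ w0]]]]]]]]]]].
  by apply/is_derive1_derivable.
exists (w 0), u, v; split=> // t tT;
  have [dx [dy [dz [du [dv [_ [xE [yE [zE [uE [vE _]]]]]]]]]]] := H t tT;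
  apply/is_derive1_derivable; split=> //.
- by rewrite zE wE// !ltW//; case/andP: tT.
- by rewrite uE wE ?(andP tT)//; [ring|case/andP: tT => *; rewrite !ltW].
- by rewrite vE wE ?(andP tT)//; [ring|case/andP: tT => *; rewrite !ltW].
Qed.

Context (w : R).

Lemma ham_flow_shift T x y z u v a e : ham_flow f T w x y z u v ->
  0 <= a -> 0 < e -> a + e <= T ->
  ham_flow f e w (fun s => x (a + s)) (fun s => y (a + s)) (fun s => z (a + s))
    (fun s => u (a + s)) (fun s => v (a + s)).
Proof.
move=> [T0 cx cy cz cu cv dx dy dz du dv] a0 e0 aT.
have sh t : 0 < t < e -> 0 < a + t < T by move=> /andP[? ?]; apply/andP; lra.
by split=> //; do ?[exact: within_shift aT _];
  move=> t /sh h; apply: is_derive1_shift; auto.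
Qed.

Context (T : R) (x y z u v : R -> R).
Hypothesis H : ham_flow f T w x y z u v.

Lemma within_f_rad : {within `[0, T], continuous (fun t => f (rad x y t))}.
Proof.
have -> : (fun t => f (rad x y t)) = fun t => (fun r : R => f `|r|) (rad x y t).
  by apply/funext => t; rewrite ger0_norm ?rad_ge0.
apply: within_cont_comp (f_normr_continuous fF).
apply: within_cont_comp; last exact: sqrt_continuous.
by apply: within_contD; apply: within_contM; [exact: ham_cx H|exact: ham_cx H|
  exact: ham_cy H|exact: ham_cy H].
Qed.

(** The force acting on (u, v) is - w^2 / 2 times the gradient of f(r)^2, so the change of u^2 + v^2
    cancels that of w^2 f(r)^2. *)
Lemma energy_cst t : 0 <= t <= T ->
  energy f w x y u v t = energy f w x y u v 0.
Proof.
move: t; apply: const_of_derive.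
  apply: within_contD; first by apply: within_contD; apply: within_contM;
    [exact: ham_cu H|exact: ham_cu H|exact: ham_cv H|exact: ham_cv H].
  apply: within_contM; first exact: cst_continuous.
  by apply: within_contM; exact: within_f_rad.
move=> t tT.
have hu := ham_du H tT; have hv := ham_dv H tT.
have hf := f_rad_sqr_derive fF (ham_dx H tT) (ham_dy H tT).
have h := is_derive1D (sqr_norm_derive hu hv)
  (is_derive1M (is_derive_cst (w ^+ 2) t 1) hf).
by apply: is_derive_eq h _; rewrite /cst; ring.
Qed.

End ham_flow.

Lemma L2_continuous (R : realType) (T : R) (p : R -> R) :
  {within `[0, T], continuous p} -> L2 T p.
Proof.
move=> cp; split.
  exact: subspace_continuous_measurable_fun.
have : (@lebesgue_measure R).-integrable `[0, T] (EFin \o (fun t => p t * p t)).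
  apply: continuous_compact_integrable; first exact: segment_compact.
  exact: within_contM.
move=> /integrableP[_]; apply: le_lt_trans.
rewrite le_eqVlt; apply/orP; left; apply/eqP; apply: eq_integral => t _ /=.
by rewrite -expr2 ger0_norm// sqr_ge0.
Qed.

(** * Admissibility, speed and length of normal trajectories *)

Section ham_flow_length.
Context (R : realType) (f : R -> R) (w c T : R) (x y z u v : R -> R).
Hypothesis fF : in_frakF f.
Hypothesis H : ham_flow f T w x y z u v.
Hypothesis c0 : 0 <= c.
Hypothesis Ec : energy f w x y u v 0 = c ^+ 2.

Let E t : 0 <= t <= T -> u t ^+ 2 + v t ^+ 2 + w ^+ 2 * f (rad x y t) ^+ 2 = c ^+ 2.
Proof. by move=> tT; rewrite -Ec -(energy_cst fF H tT). Qed.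

Let E_bounds t : 0 <= t <= T ->
  [/\ `|u t| <= c, `|v t| <= c & `|f (rad x y t) * w| <= c].
Proof.
move=> /E h.
have h1 := sqr_ge0 (u t); have h2 := sqr_ge0 (v t).
have h3 := sqr_ge0 (f (rad x y t) * w).
have eq3 : w ^+ 2 * f (rad x y t) ^+ 2 = (f (rad x y t) * w) ^+ 2 by ring.
by split; rewrite -(@ler_pXn2r _ 2) ?nnegrE// real_normK ?num_real//; lra.
Qed.

Let sub_within (p : R -> R) s t : 0 <= s -> t <= T ->
  {within `[0, T], continuous p} -> {within `[s, t], continuous p}.
Proof.
move=> s0 tT; apply: continuous_subspaceW => r; rewrite /= !in_itv/=.
by move=> /andP[sr rt]; rewrite (le_trans s0 sr) (le_trans rt tT).
Qed.

Lemma ham_x_lipschitz s t : 0 <= s -> s <= t -> t <= T ->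
  `|x t - x s| <= c * (t - s).
Proof.
move=> s0 st tT; apply: lipschitz_of_derive => //.
  exact: sub_within (ham_cx H).
move=> r /andP[sr rt]; exists (u r); first by apply: (ham_dx H); apply/andP; lra.
by have [] := E_bounds (t := r); first by apply/andP; lra.
Qed.

Lemma ham_y_lipschitz s t : 0 <= s -> s <= t -> t <= T ->
  `|y t - y s| <= c * (t - s).
Proof.
move=> s0 st tT; apply: lipschitz_of_derive => //.
  exact: sub_within (ham_cy H).
move=> r /andP[sr rt]; exists (v r); first by apply: (ham_dy H); apply/andP; lra.
by have [] := E_bounds (t := r); first by apply/andP; lra.
Qed.

Lemma ham_z_lipschitz : exists2 K, 0 <= K &
  forall s t, 0 <= s -> s <= t -> t <= T -> `|z t - z s| <= K * (t - s).
Proof.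
have T0 := ham_T H.
have [m mT mP] := EVT_max (ltW T0) (within_f_rad fF H).
(* |z'| = f(r) |f(r) w|: the first factor is at most its maximum on [[0, T]], the second at most [c]
   by the energy. *)
exists (f (rad x y m) * c).
  by apply: mulr_ge0 => //; exact: frakF_ge0 (rad_ge0 _ _ _).
move=> s t s0 st tT.
apply: lipschitz_of_derive => //; first exact: sub_within (ham_cz H).
move=> r /andP[sr rt]; exists (f (rad x y r) ^+ 2 * w).
  by apply: (ham_dz H); apply/andP; lra.
have rT : 0 <= r <= T by apply/andP; lra.
have [_ _ h] := E_bounds rT.
have := mP r; rewrite in_itv/= => /(_ rT).
have f0 := frakF_ge0 fF (rad_ge0 x y r).
rewrite expr2 -mulrA normrM (ger0_norm f0) => h2.
by apply: ler_pM.
Qed.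

Lemma ham_admissible : admissible f T x y z.
Proof.
have T0 := ham_T H.
split; first exact: ltW.
split; first by apply: abs_cont_lipschitz; exact: ham_x_lipschitz.
split; first by apply: abs_cont_lipschitz; exact: ham_y_lipschitz.
split; first by have [K _ hK] := ham_z_lipschitz; exact: abs_cont_lipschitz hK.
(* The third control is f(r) w, one factor f(r) of z' = f(r)^2 w belonging to the field Z_f. *)
exists u, v, (fun t => f (rad x y t) * w).
split; first exact: L2_continuous (ham_cu H).
split; first exact: L2_continuous (ham_cv H).
split.
  apply/L2_continuous/within_contM; first exact: within_f_rad H.
  by move=> t; exact: cst_continuous.
apply: lebesgue_aeS2 (lebesgue_ae_neq 0) (lebesgue_ae_neq T) => t /eqP t_0 /eqP t_T.
rewrite !le_eqVlt eq_sym (negbTE t_0) (negbTE t_T)/= => tT.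
have /is_derive1_derivable[dx xE] := ham_dx H tT.
have /is_derive1_derivable[dy yE] := ham_dy H tT.
have /is_derive1_derivable[dz zE] := ham_dz H tT.
by do 5 split=> //; rewrite zE; ring.
Qed.

Lemma ham_speed t : 0 < t < T -> speed f x y z t = c.
Proof.
move=> tT.
have /is_derive1_derivable[_ xE] := ham_dx H tT.
have /is_derive1_derivable[_ yE] := ham_dy H tT.
have /is_derive1_derivable[_ zE] := ham_dz H tT.
rewrite /speed xE yE zE -[RHS](ger0_norm c0) -sqrtr_sqr -(E (t := t)); last first.
  by case/andP: tT => *; rewrite !ltW.
congr (Num.sqrt (_ + _)).
(* Where f(r) = 0 the convention 0 / 0 = 0 gives exactly the vanishing energy term. *)
have [->|f_neq0] := eqVneq (f (rad x y t)) 0.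
  by rewrite expr0n/= invr0 !mulr0.
by field.
Qed.

Lemma ham_constant_speed : constant_speed f T x y z.
Proof.
exists c.
apply: lebesgue_aeS2 (lebesgue_ae_neq 0) (lebesgue_ae_neq T) => t /eqP t_0 /eqP t_T.
by rewrite !le_eqVlt eq_sym (negbTE t_0) (negbTE t_T)/=; exact: ham_speed.
Qed.

Lemma ham_length : length f T x y z = (c * T)%:E.
Proof.
have T0 := ham_T H.
rewrite /length (@eq_integral_itv_bounded _ _ _ (fun=> c))//.
- have muT : @lebesgue_measure R `[0, T]%classic = T%:E.
    by rewrite lebesgue_measure_itv/= lte_fin T0 oppr0 addr0.
  by rewrite integral_cst//= [X in (_ * X)%E]muT.
- apply: (eq_measurable_fun (fun=> c)) => [t|]; last exact: measurable_cst.
  by rewrite inE/= in_itv/= => /ham_speed.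
- by move=> t; rewrite in_itv/= => /ham_speed.
Qed.

End ham_flow_length.

Lemma energy_ge0 (R : realType) (f : R -> R) w x y u v (t : R) :
  0 <= energy f w x y u v t.
Proof. by rewrite /energy -exprMn !addr_ge0// sqr_ge0. Qed.

(** Zero energy forces u = v = w f(r) = 0 at all times, hence a constant curve. Nonconstancy thus
    provides c > 0, by which times and lengths are converted. *)
Lemma energy_gt0 (R : realType) (f : R -> R) (w T : R) (x y z u v : R -> R) :
  in_frakF f -> ham_flow f T w x y z u v -> nonconstant T x y z ->
  0 < energy f w x y u v 0.
Proof.
move=> fF H [t [tT ne]]; rewrite lt_neqAle energy_ge0 andbT eq_sym.
apply/eqP => E0; apply: ne.
have Es s : 0 <= s <= T -> [/\ u s = 0, v s = 0 & w * f (rad x y s) = 0].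
  move=> /(energy_cst fF H); rewrite E0 /energy -exprMn => h.
  have h1 := sqr_ge0 (u s); have h2 := sqr_ge0 (v s).
  have h3 := sqr_ge0 (w * f (rad x y s)).
  by split; apply/eqP; rewrite -sqrf_eq0; apply/eqP; lra.
have cl s : 0 < s < T -> 0 <= s <= T by move=> /andP[? ?]; rewrite !ltW.
split; [|split].
- apply: const_of_derive tT; first exact: ham_cx H.
  by move=> s sT; have [u0 _ _] := Es s (cl s sT); rewrite -u0; exact: ham_dx H s sT.
- apply: const_of_derive tT; first exact: ham_cy H.
  by move=> s sT; have [_ v0 _] := Es s (cl s sT); rewrite -v0; exact: ham_dy H s sT.
- apply: const_of_derive tT; first exact: ham_cz H.
  move=> s sT; have [_ _ f0] := Es s (cl s sT).
  apply: is_derive_eq (ham_dz H sT) _.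
  by rewrite expr2 -mulrA (mulrC _ w) f0 mulr0.
Qed.

(** * Calibration away from the axis *)

Lemma continuous_atD (R : realType) (p q : R -> R) (t : R) :
  {for t, continuous p} -> {for t, continuous q} ->
  {for t, continuous (fun s => p s + q s)}.
Proof. by move=> cp cq; exact: cvgD. Qed.

Lemma continuous_atM (R : realType) (p q : R -> R) (t : R) :
  {for t, continuous p} -> {for t, continuous q} ->
  {for t, continuous (fun s => p s * q s)}.
Proof. by move=> cp cq; exact: cvgM. Qed.

Lemma continuous_atV (R : realType) (p : R -> R) (t : R) :
  p t != 0 -> {for t, continuous p} -> {for t, continuous (fun s => (p s)^-1)}.
Proof. by move=> pt cp; exact: cvgV. Qed.

(** The mean value inequality applied twice; it gives [K] as the maximum of [|p2|] and treats both
    positions of [s] relative to [r]. *)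
Lemma taylor_bound (R : realType) (a b : R) (p p1 p2 : R -> R) : a <= b ->
  (forall r, a <= r <= b -> is_derive r 1 p (p1 r)) ->
  (forall r, a <= r <= b -> is_derive r 1 p1 (p2 r)) ->
  {within `[a, b], continuous p2} ->
  exists2 K, 0 <= K & forall r s, a <= r <= b -> a <= s <= b ->
    `|p s - p r - p1 r * (s - r)| <= K * (s - r) ^+ 2.
Proof.
move=> ab dp dp1 cp2.
have [m _ mP] := EVT_max ab (within_cont_comp cp2 (@norm_continuous _ R^o)).
have mP' r : a <= r <= b -> `|p2 r| <= `|p2 m|.
  by move=> rab; apply: mP; rewrite in_itv.
have within_of (q q1 : R -> R) l r : a <= l -> r <= b ->
    (forall r, a <= r <= b -> is_derive r 1 q (q1 r)) ->
    {within `[l, r], continuous q}.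
  move=> al rb dq; apply: continuous_in_subspaceT => s; rewrite inE/= in_itv/=.
  move=> /andP[ls sr]; have /dq/is_derive1_derivable[+ _] : a <= s <= b.
    by rewrite (le_trans al ls) (le_trans sr rb).
  exact: derivable_cts.
have lip l r : a <= l -> l <= r -> r <= b -> `|p1 r - p1 l| <= `|p2 m| * (r - l).
  move=> al lr rb; apply: lipschitz_of_derive => //; first exact: within_of dp1.
  move=> s /andP[ls sr]; exists (p2 s); first by apply: dp1; apply/andP; lra.
  by apply: mP'; apply/andP; lra.
have lip2 l r : a <= l <= b -> a <= r <= b -> `|p1 r - p1 l| <= `|p2 m| * `|r - l|.
  move=> /andP[al lb] /andP[ar rb]; have [lr|/ltW rl] := leP l r.
    by rewrite (ger0_norm (_ : 0 <= r - l)) ?subr_ge0//; exact: lip.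
  rewrite distrC (distrC r) (ger0_norm (_ : 0 <= l - r)) ?subr_ge0//.
  exact: lip.
exists `|p2 m| => // r s rab sab.
(* Without its linear part at [r], the function has derivative [p1 t - p1 r], already of size K |s -
   r| between [r] and [s]. *)
pose q t := p t + (- p1 r) * t.
have dq t : a <= t <= b -> is_derive t 1 q (p1 t - p1 r).
  move=> /dp h.
  have h' := is_derive1D h (is_derive1M (is_derive_cst (- p1 r) t 1) (is_derive_id t 1)).
  by apply: is_derive_eq h' _; rewrite mul0r add0r /cst mulr1.
have main l t K : a <= l -> l <= t -> t <= b ->
    (forall o, l < o < t -> `|p1 o - p1 r| <= K) -> `|q t - q l| <= K * (t - l).
  move=> al lt tb HK; apply: lipschitz_of_derive => //; first exact: within_of dq.
  move=> o lot; exists (p1 o - p1 r); last exact: HK.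
  by apply: dq; case/andP: lot => *; apply/andP; lra.
have -> : p s - p r - p1 r * (s - r) = q s - q r by rewrite /q; ring.
have K0 := normr_ge0 (p2 m); move/andP: rab => [ar rb]; move/andP: sab => [as_ sb].
have [rs|/ltW sr] := leP r s.
  rewrite expr2 mulrA; apply: main => // o /andP[ro os].
  apply: (le_trans (lip2 r o _ _)); try by apply/andP; lra.
  by rewrite ler_wpM2l// ger0_norm; lra.
have -> : `|p2 m| * (s - r) ^+ 2 = `|p2 m| * (r - s) * (r - s) by ring.
rewrite distrC; apply: main => // o /andP[ro os].
apply: (le_trans (lip2 r o _ _)); try by apply/andP; lra.
by rewrite ler_wpM2l// ler0_norm; lra.
Qed.

(* [2 * sqr_slope f r * (x, y)] is the gradient of f(r)^2. *)
Definition sqr_slope (R : realType) (f : R -> R) (r : R) := f r * derive1 f r / r.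

(** f^2 is viewed as a C^2 function [p] of the scalar r^2, with p' = f f'/r. A scalar expansion
    avoids second partial derivatives and any convexity of the annulus. The increment of r^2 is 2
    <q, h> + |h|^2, so the error consists of p' |h|^2 and the Taylor remainder; hence K = G + 4 b
    K1. *)
Lemma f_sqr_semiconcave (R : realType) (f : R -> R) (a b : R) :
  in_frakF f -> 0 < a -> a <= b -> exists K G, [/\ 0 <= K, 0 <= G &
   forall x y X Y : R, a <= x ^+ 2 + y ^+ 2 <= b -> a <= X ^+ 2 + Y ^+ 2 <= b ->
     `|sqr_slope f (Num.sqrt (x ^+ 2 + y ^+ 2))| <= G /\
     f (Num.sqrt (X ^+ 2 + Y ^+ 2)) ^+ 2 - f (Num.sqrt (x ^+ 2 + y ^+ 2)) ^+ 2
     - 2 * sqr_slope f (Num.sqrt (x ^+ 2 + y ^+ 2)) * (x * (X - x) + y * (Y - y))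
     <= K * ((X - x) ^+ 2 + (Y - y) ^+ 2)].
Proof.
move=> fF a0 ab.
pose p r := f (Num.sqrt r) ^+ 2.
pose p1 r := sqr_slope f (Num.sqrt r).
(* The derivative of [sqr_slope f]. *)
pose q r := ((derive1 f r ^+ 2 + f r * derive1 (derive1 f) r) * r
             - f r * derive1 f r) / r ^+ 2.
pose p2 r := q (Num.sqrt r) * (2 * Num.sqrt r)^-1.
have [_ [df _]] := fF.
have f1 (r : R) : 0 < r -> is_derive r 1 f (derive1 f r) by exact: frakF_derive.
have f2 (r : R) : 0 < r -> is_derive r 1 (derive1 f) (derive1 (derive1 f) r).
  by move=> /df[_ [d2 _]]; apply/is_derive1_derivable.
have pos (r : R) : a <= r <= b -> 0 < Num.sqrt r.
  by move=> /andP[ar _]; rewrite sqrtr_gt0 (lt_le_trans a0).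
have dsq (r : R) : a <= r <= b -> is_derive r 1 (@Num.sqrt R) (2 * Num.sqrt r)^-1.
  by move=> /pos; rewrite sqrtr_gt0; exact: is_derive1_sqrt.
have dp (r : R) : a <= r <= b -> is_derive r 1 p (p1 r).
  move=> rab; have s0 := pos r rab.
  have h := @is_derive1_comp _ _ _ _ _ _ (is_derive1M (f1 _ s0) (f1 _ s0)) (dsq r rab).
  by apply: is_derive_eq h _; rewrite /p1 /sqr_slope; field; rewrite gt_eqF.
have dslope (r : R) : 0 < r -> is_derive r 1 (sqr_slope f) (q r).
  move=> r0.
  have hV : is_derive r 1 (fun s : R => s^-1) (- r ^- 2).
    have h := @is_deriveV R id r 1 1 (lt0r_neq0 r0) (is_derive_id r 1).
    by apply: is_derive_eq h _; rewrite /GRing.scale/= mulr1.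
  have h := is_derive1M (is_derive1M (f1 _ r0) (f2 _ r0)) hV.
  by apply: is_derive_eq h _; rewrite /q; field; rewrite gt_eqF.
have dp1 (r : R) : a <= r <= b -> is_derive r 1 p1 (p2 r).
  by move=> rab; exact: is_derive1_comp (dslope _ (pos r rab)) (dsq r rab).
have cq (r : R) : 0 < r -> {for r, continuous q}.
  move=> r0; have [_ [_ c2]] := df r r0.
  have c0 := derivable_cts (proj1 ((is_derive1_derivable _ _ _).1 (f1 r r0))).
  have c1 := derivable_cts (proj1 ((is_derive1_derivable _ _ _).1 (f2 r r0))).
  have cV : {for r, continuous (fun s : R => (s ^+ 2)^-1)}.
    apply: continuous_atV; first by rewrite expf_eq0/= gt_eqF.
    exact: exprn_continuous.
  have cid : {for r, continuous (id : R -> R)} by exact: cvg_id.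
  have cN : {for r, continuous (fun s => - (f s * derive1 f s))}.
    by apply: cvgN; exact: continuous_atM.
  apply: continuous_atM cV; apply: continuous_atD cN.
  apply: continuous_atM cid; apply: continuous_atD; apply: continuous_atM => //.
have cp2 : {within `[a, b], continuous p2}.
  apply: continuous_in_subspaceT => r; rewrite inE/= in_itv/= => rab.
  have s0 := pos r rab.
  have csq : {for r, continuous (@Num.sqrt R)} by exact: sqrt_continuous.
  apply: (@continuous_atM _ (fun r => q (Num.sqrt r)) (fun r => (2 * Num.sqrt r)^-1)).
    by apply: (@continuous_comp _ _ _ (@Num.sqrt R) q) => //; exact: cq.
  apply: continuous_atV; first by rewrite mulf_neq0// gt_eqF.
  by apply: continuous_atM => //; exact: cvg_cst.
have [K1 K10 K1P] := taylor_bound ab dp dp1 cp2.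
have cp1 : {within `[a, b], continuous p1}.
  apply: continuous_in_subspaceT => r; rewrite inE/= in_itv/= => rab.
  exact: derivable_cts (proj1 ((is_derive1_derivable _ _ _).1 (dp1 r rab))).
have [m _ mP] := EVT_max ab (within_cont_comp cp1 (@norm_continuous _ R^o)).
exists (`|p1 m| + 4 * b * K1), `|p1 m|; split=> //.
  by rewrite addr_ge0// !mulr_ge0//; lra.
move=> x y X Y h0 h1.
have hG : `|p1 (x ^+ 2 + y ^+ 2)| <= `|p1 m| by apply: mP; rewrite in_itv.
split=> //; have := K1P _ _ h0 h1.
rewrite -/(p (X ^+ 2 + Y ^+ 2)) -/(p (x ^+ 2 + y ^+ 2)) -/(p1 (x ^+ 2 + y ^+ 2)).
move=> /(le_trans (ler_norm _)) hT.
have {}hG := le_trans (ler_norm _) hG.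
set P1 := p (X ^+ 2 + Y ^+ 2) in hT *; set P0 := p _ in hT *.
set g := p1 _ in hT hG *; set G := `|p1 m| in hG *.
set D := (X - x) ^+ 2 + (Y - y) ^+ 2.
have D0 : 0 <= D by rewrite addr_ge0// sqr_ge0.
(* Cauchy-Schwarz for the sum and the difference of the two points; the squared norm of the sum is
   at most 4 b. *)
have hr : (X ^+ 2 + Y ^+ 2 - (x ^+ 2 + y ^+ 2)) ^+ 2 <= 4 * b * D.
  apply: (@le_trans _ _ (((X + x) ^+ 2 + (Y + y) ^+ 2) * D)).
    rewrite -subr_ge0 (_ : _ - _ = ((X + x) * (Y - y) - (Y + y) * (X - x)) ^+ 2).
      exact: sqr_ge0.
    by rewrite /D; ring.
  rewrite ler_wpM2r//.
  have := sqr_ge0 (X - x); have := sqr_ge0 (Y - y).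
  by move: h0 h1 => /andP[_ h0] /andP[_ h1]; nra.
have hK := ler_wpM2l K10 hr.
have hg : g * D <= G * D by rewrite ler_wpM2r.
have eqD : X ^+ 2 + Y ^+ 2 - (x ^+ 2 + y ^+ 2) =
  2 * (x * (X - x) + y * (Y - y)) + D by rewrite /D; ring.
have : P1 - P0 <= g * (2 * (x * (X - x) + y * (Y - y)) + D) + K1 * (4 * b * D).
  by rewrite -eqD; lra.
lra.
Qed.

Lemma is_derive1N (R : realType) (p : R -> R) (t a : R) :
  is_derive t 1 p a -> is_derive t 1 (fun s => - p s) (- a).
Proof. by move=> hp; exact: is_deriveN. Qed.

Lemma abs_contN (R : realType) (a b : R) (g : R -> R) :
  abs_cont a b g -> abs_cont a b (fun t => - g t).
Proof.
move=> ac; apply: (abs_cont_dom (K := 1) ac ac) => s t _ _ _.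
by rewrite mul1r -opprD normrN lerDl.
Qed.

Lemma within_contN (R : realType) (A : set R) (p : R -> R) :
  {within A, continuous p} -> {within A, continuous (fun t => - p t)}.
Proof. by move=> cp; apply: within_cont_comp cp _; exact: opp_continuous. Qed.

Lemma abs_cont_comp (R : realType) (T e K : R) (p s : R -> R) :
  0 <= K ->
  (forall a b, 0 <= a -> a <= b -> b <= e -> `|p b - p a| <= K * (b - a)) ->
  abs_cont 0 T s ->
  (forall t, 0 <= t <= T -> 0 <= s t <= e) ->
  abs_cont 0 T (fun t => p (s t)).
Proof.
move=> K0 lip acs hs; apply: (abs_cont_dom (K := K) acs acs) => a b a0 ab bT.
have /andP[sa0 sae] : 0 <= s a <= e by apply: hs; apply/andP; lra.
have /andP[sb0 sbe] : 0 <= s b <= e by apply: hs; apply/andP; lra.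
apply: (@le_trans _ _ (K * `|s b - s a|)); last by rewrite ler_wpM2l// lerDl.
have [h|/ltW h] := leP (s a) (s b).
  by rewrite (ger0_norm (_ : 0 <= s b - s a)) ?subr_ge0//; exact: lip.
rewrite distrC (distrC (s b)) (ger0_norm (_ : 0 <= s a - s b)) ?subr_ge0//.
exact: lip.
Qed.

(* Time-dependent calibration: a first-order expansion of the action around
   the trajectory, bent down transversally by the term [M / 2 * t * |h|^2]. *)
Definition calibration (R : realType) (w c M : R) (x y z u v : R -> R)
    (X Y Z t : R) : R :=
  u t * (X + - x t) + v t * (Y + - y t) + w * (Z + - z t) + c ^+ 2 / 2 * t
  + - (M / 2) * (t * ((X + - x t) * (X + - x t) + (Y + - y t) * (Y + - y t))).

(** Partial derivative of [calibration] in [t], in which energy conservation has reduced - u^2 - v^2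
    - w^2 f^2 + c^2 / 2 to - c^2 / 2. *)
Definition calibration_dt (R : realType) (f : R -> R) (w c M : R)
    (x y u v : R -> R) (X Y t : R) : R :=
  - (w ^+ 2 * sqr_slope f (rad x y t) * (x t * (X - x t) + y t * (Y - y t)))
  - c ^+ 2 / 2 + M * t * ((X - x t) * u t + (Y - y t) * v t)
  - M / 2 * ((X - x t) ^+ 2 + (Y - y t) ^+ 2).

(** [F0] and [F1] are the values of f^2 on the trajectory and at the displaced point, and h is the
    planar displacement. The cross terms M t <h, (u, v)> cancel. Twice the rest is the error of f^2
    plus (M t)^2 |h|^2 minus M |h|^2, and each of the first two costs at most M / 2 |h|^2. *)
Lemma hamilton_jacobi_ineq (R : realFieldType)
    (u v w F0 F1 g h1 h2 xh K M t c : R) :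
  u ^+ 2 + v ^+ 2 + w ^+ 2 * F0 = c ^+ 2 ->
  F1 - F0 - 2 * g * xh <= K * (h1 ^+ 2 + h2 ^+ 2) ->
  w ^+ 2 * K <= M / 2 -> (M * t) ^+ 2 <= M / 2 ->
  ((u - M * t * h1) ^+ 2 + (v - M * t * h2) ^+ 2 + w ^+ 2 * F1) / 2 +
  (- (w ^+ 2 * g * xh) - c ^+ 2 / 2 + M * t * (h1 * u + h2 * v)
   - M / 2 * (h1 ^+ 2 + h2 ^+ 2)) <= 0.
Proof.
move=> hE hF hK hM.
have D0 : 0 <= h1 ^+ 2 + h2 ^+ 2 by rewrite addr_ge0// sqr_ge0.
have A1 := ler_wpM2l (sqr_ge0 w) hF.
have A2 := ler_wpM2r D0 hK.
have A3 := ler_wpM2r D0 hM.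
have : w ^+ 2 * (F1 - F0 - 2 * g * xh) + (M * t) ^+ 2 * (h1 ^+ 2 + h2 ^+ 2)
  <= M * (h1 ^+ 2 + h2 ^+ 2) by move: A1 A2 A3; rewrite mulrA; lra.
rewrite -hE => A4.
set L := (X in X <= 0).
have -> : L = (w ^+ 2 * (F1 - F0 - 2 * g * xh) + (M * t) ^+ 2 * (h1 ^+ 2 + h2 ^+ 2)
  - M * (h1 ^+ 2 + h2 ^+ 2)) / 2 by rewrite /L; field.
by lra.
Qed.

Section calibration_derive.
Context (R : realType) (f : R -> R) (w c M T : R) (x y z u v : R -> R).
Hypothesis fF : in_frakF f.
Hypothesis H : ham_flow f T w x y z u v.
Hypothesis Ec : energy f w x y u v 0 = c ^+ 2.

Lemma calibration_derive (X Y Z s : R -> R) (t X' Y' Z' s' : R) :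
  0 < s t < T ->
  is_derive t 1 X X' -> is_derive t 1 Y Y' -> is_derive t 1 Z Z' ->
  is_derive t 1 s s' ->
  is_derive t 1 (fun r => calibration w c M x y z u v (X r) (Y r) (Z r) (s r))
    ((u (s t) - M * s t * (X t - x (s t))) * X' +
     (v (s t) - M * s t * (Y t - y (s t))) * Y' + w * Z' +
     calibration_dt f w c M x y u v (X t) (Y t) (s t) * s').
Proof.
move=> sT dX dY dZ ds.
have dcomp (p : R -> R) (p' : R) : is_derive (s t) 1 p p' ->
    is_derive t 1 (fun r => p (s r)) (p' * s').
  by move=> hp; exact: is_derive1_comp hp ds.
have dx := dcomp _ _ (ham_dx H sT); have dy := dcomp _ _ (ham_dy H sT).
have dz := dcomp _ _ (ham_dz H sT); have du := dcomp _ _ (ham_du H sT).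
have dv := dcomp _ _ (ham_dv H sT).
have dX1 := is_derive1D dX (is_derive1N dx).
have dY1 := is_derive1D dY (is_derive1N dy).
have dZ1 := is_derive1D dZ (is_derive1N dz).
have h1 := is_derive1D (is_derive1D (is_derive1M du dX1) (is_derive1M dv dY1))
  (is_derive1M (is_derive_cst w t 1) dZ1).
have h2 := is_derive1M (is_derive_cst (c ^+ 2 / 2) t 1) ds.
have h3 := is_derive1M (is_derive_cst (- (M / 2)) t 1)
  (is_derive1M ds (is_derive1D (is_derive1M dX1 dX1) (is_derive1M dY1 dY1))).
have h := is_derive1D (is_derive1D h1 h2) h3.
apply: is_derive_eq h _.
have sT' : 0 <= s t <= T by case/andP: sT => *; rewrite !ltW.
have := energy_cst fF H sT'; rewrite Ec /energy => hE.
rewrite /calibration_dt -hE /sqr_slope /cst.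
by set g := f _ * derive1 f _ / _; field.
Qed.

Lemma within_calibration (X Y Z : R) :
  {within `[0, T], continuous (calibration w c M x y z u v X Y Z)}.
Proof.
have cc (k : R) : {within `[0, T], continuous (fun _ : R => k)}.
  by move=> t; exact: cst_continuous.
have cid : {within `[0, T], continuous (fun t : R => t)}.
  by apply: continuous_subspaceT => t; exact: cvg_id.
have cX := within_contD (cc X) (within_contN (ham_cx H)).
have cY := within_contD (cc Y) (within_contN (ham_cy H)).
have cZ := within_contD (cc Z) (within_contN (ham_cz H)).
apply: within_contD; first apply: within_contD; first apply: within_contD;
  first apply: within_contD.
- exact: within_contM (ham_cu H) cX.
- exact: within_contM (ham_cv H) cY.
- exact: within_contM (cc w) cZ.
- exact: within_contM (cc _) cid.
- apply: within_contM (cc _) _; apply: within_contM cid _.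
  by apply: within_contD; exact: within_contM.
Qed.

End calibration_derive.

Lemma abs_cont_increment_le (R : realType) (T : R) (p F : R -> R) :
  abs_cont 0 T p -> abs_cont 0 T F ->
  {ae @lebesgue_measure R, forall t, 0 <= t <= T -> exists a b,
     [/\ is_derive t 1 p a, is_derive t 1 F b & a <= b]} ->
  forall t, 0 <= t <= T -> p t - p 0 <= F t - F 0.
Proof.
move=> acp acF hae t /andP[t0 tT].
have ac := abs_contS (lexx 0) tT (abs_contD acp (abs_contN acF)).
have : p t + - F t <= p 0 + - F 0; last by lra.
apply: (abs_cont_le (p := fun t => p t + - F t) t0 ac).
apply: (lebesgue_aeS _ hae) => s h /andP[s0 st].
have [|a [b [hp hF ab]]] := h; first by rewrite s0 (le_trans st tT).
have /is_derive1_derivable[d ->] := is_derive1D hp (is_derive1N hF).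
by split=> //; lra.
Qed.

(** The displacement has norm at most r sqrt 2 / 4, less than r / 2. The box therefore avoids the
    axis and lies in an annulus where the expansion of f^2 is uniform. *)
Lemma planar_box (R : realFieldType) (r x0 y0 X Y : R) :
  0 <= r -> r ^+ 2 = x0 ^+ 2 + y0 ^+ 2 ->
  `|X - x0| <= r / 4 -> `|Y - y0| <= r / 4 ->
  r ^+ 2 / 4 <= X ^+ 2 + Y ^+ 2 <= 4 * r ^+ 2.
Proof.
move=> r0 hr hX hY.
have sq a : `|a| <= r / 4 -> a ^+ 2 <= r ^+ 2 / 16.
  move=> ha; rewrite -real_normK ?num_real//.
  have -> : r ^+ 2 / 16 = (r / 4) ^+ 2 by field.
  by rewrite ler_pXn2r ?nnegrE// divr_ge0.
have := sq _ hX; have := sq _ hY.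
(* These squares bound the mixed term 2 (X - x0) x0 from below, and the next ones from above. *)
have := sqr_ge0 (X - x0 + (X - x0) + x0); have := sqr_ge0 (Y - y0 + (Y - y0) + y0).
have := sqr_ge0 (X - x0 - x0); have := sqr_ge0 (Y - y0 - y0).
by rewrite hr => *; apply/andP; split; nra.
Qed.

(** The covectors dx, dy and their opposites satisfy 2 H = 1, so their pairing with the velocity is
    at most F'. *)
Lemma arc_length_dist (R : realType) (f : R -> R) (T : R) (x y z F : R -> R) :
  abs_cont 0 T x -> abs_cont 0 T y -> abs_cont 0 T F -> F 0 = 0 ->
  arc_majorant f T x y z F ->
  forall t, 0 <= t <= T -> `|x t - x 0| <= F t /\ `|y t - y 0| <= F t.
Proof.
move=> acx acy acF F0 aeF t tT.
have inc p1 p2 : p1 ^+ 2 + p2 ^+ 2 = 1 ->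
    p1 * (x t - x 0) + p2 * (y t - y 0) <= F t.
  move=> p12; have acp : abs_cont 0 T (fun t => p1 * x t + p2 * y t).
    by apply: abs_contD; apply: abs_contM => //; exact: abs_cont_cst.
  suff : (p1 * x t + p2 * y t) - (p1 * x 0 + p2 * y 0) <= F t - F 0.
    by rewrite F0; lra.
  apply: (abs_cont_increment_le acp acF) => //.
  apply: (lebesgue_aeS _ aeF) => s h sT.
  have [dx dy _ dF [_ hp]] := h sT.
  exists (p1 * derive1 x s + p2 * derive1 y s), (derive1 F s); split.
  - have hx : is_derive s 1 x (derive1 x s) by apply/is_derive1_derivable.
    have hy : is_derive s 1 y (derive1 y s) by apply/is_derive1_derivable.
    have h' := is_derive1D (is_derive1M (is_derive_cst p1 s 1) hx)
      (is_derive1M (is_derive_cst p2 s 1) hy).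
    by apply: is_derive_eq h' _; rewrite /cst; ring.
  - by apply/is_derive1_derivable.
  - have h1 : p1 ^+ 2 + p2 ^+ 2 + 0 ^+ 2 * f (rad x y s) ^+ 2 <= 1 ^+ 2.
      by rewrite p12 expr0n/= mul0r addr0 expr1n.
    by have := hp p1 p2 0 1 ler01 h1; rewrite mul1r mul0r addr0.
have i1 := inc 1 0 (ltac:(ring)); have i2 := inc (-1) 0 (ltac:(ring)).
have i3 := inc 0 1 (ltac:(ring)); have i4 := inc 0 (-1) (ltac:(ring)).
by split; rewrite ler_norml; apply/andP; split; lra.
Qed.

(** Young's inequality c N <= N^2 / 2 + c^2 / 2: it turns the Hamilton-Jacobi inequality into a
    growth rate of at most c^2 / 2 along a curve of speed c. *)
Lemma young_le0 (R : realFieldType) (c N b : R) :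
  N ^+ 2 / 2 + b <= 0 -> c * N + b - c ^+ 2 / 2 <= 0.
Proof. by have := sqr_ge0 (c - N); nra. Qed.

Section off_axis.
Context (R : realType) (f : R -> R) (w c T : R) (x y z u v : R -> R).
Hypothesis fF : in_frakF f.
Hypothesis H : ham_flow f T w x y z u v.
Hypothesis c0 : 0 < c.
Hypothesis Ec : energy f w x y u v 0 = c ^+ 2.
Hypothesis r0 : 0 < rad x y 0.

(** The slope f f'/r is bounded only while the trajectory stays in the annulus, hence the
    restriction to [[0, e]]. The bound makes u and v absolutely continuous when evaluated at a
    competitor's clock. *)
Let ham_u_lipschitz (e G B : R) : 0 <= e -> e <= T -> 0 <= G ->
  (forall t, 0 <= t <= e -> `|sqr_slope f (rad x y t)| <= G) ->
  (forall t, 0 <= t <= e -> `|x t| <= B /\ `|y t| <= B) ->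
  forall s t, 0 <= s -> s <= t -> t <= e ->
    `|u t - u s| <= w ^+ 2 * G * B * (t - s) /\
    `|v t - v s| <= w ^+ 2 * G * B * (t - s).
Proof.
move=> e0 eT G0 hG hB s t s0 st te.
have sub p : {within `[0, T], continuous p} -> {within `[s, t], continuous (p : R -> R)}.
  apply: continuous_subspaceW => r; rewrite /= !in_itv/= => /andP[sr rt].
  by apply/andP; lra.
have bnd r : s < r < t -> (0 < r < T) /\ forall q, `|q| <= B ->
    `|- (w ^+ 2 * sqr_slope f (rad x y r) * q)| <= w ^+ 2 * G * B.
  move=> /andP[sr rt]; split=> [|q hq]; first by apply/andP; lra.
  have rl : 0 <= r <= e by apply/andP; lra.
  rewrite normrN normrM [X in X * _]normrM (ger0_norm (sqr_ge0 w)).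
  apply: ler_pM => //; first by apply: mulr_ge0 => //; exact: sqr_ge0.
  by apply: ler_wpM2l; [exact: sqr_ge0|exact: hG].
split; apply: lipschitz_of_derive => //.
- exact: sub (ham_cu H).
- move=> r srt; have [rT hr] := bnd r srt.
  exists (- (w ^+ 2 * sqr_slope f (rad x y r) * x r)).
    exact: (ham_du H rT).
  apply: hr; have [] // := hB r.
  by move: srt => /andP[? ?]; apply/andP; lra.
- exact: sub (ham_cv H).
- move=> r srt; have [rT hr] := bnd r srt.
  exists (- (w ^+ 2 * sqr_slope f (rad x y r) * y r)).
    exact: (ham_dv H rT).
  apply: hr; have [] // := hB r.
  by move: srt => /andP[? ?]; apply/andP; lra.
Qed.

(** A competitor of length l < c e, clocked by d + (arc length) / c, reaches gamma(e) at time d + l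
    / c, before e. Until then S gains at most c l / 2. Waiting at gamma(e) until time e can only
    lower S, since S_t <= 0, and S ends at c^2 e / 2. As S vanishes at gamma(0) at time 0, letting d
    tend to 0 gives a contradiction. *)
Lemma off_axis_minimizing : exists e, [/\ 0 < e, e <= T &
  forall T' X Y Z, admissible f T' X Y Z ->
    X 0 = x 0 -> Y 0 = y 0 -> Z 0 = z 0 ->
    X T' = x e -> Y T' = y e -> Z T' = z e ->
    ((c * e)%:E <= length f T' X Y Z)%E].
Proof.
have T0 := ham_T H.
pose r := rad x y 0; have rpos : 0 < r by [].
have r2 : 0 < r ^+ 2 by rewrite exprn_gt0.
have rE : r ^+ 2 = x 0 ^+ 2 + y 0 ^+ 2 by exact: rad_sqr.
have a0 : 0 < r ^+ 2 / 4 by rewrite divr_gt0.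
have ab : r ^+ 2 / 4 <= 4 * r ^+ 2 by lra.
have [K [G [K0 G0 KG]]] := f_sqr_semiconcave fF a0 ab.
(* Large enough for w^2 K <= M / 2; the added 1 makes M >= 1, so that (M t)^2 <= 1 / 4 is also below
   M / 2. *)
pose M := 2 * (w ^+ 2 * K) + 1.
have wK0 : 0 <= w ^+ 2 * K by rewrite mulr_ge0// sqr_ge0.
have M1 : 1 <= M by rewrite /M; lra.
have M0 : 0 < M by lra.
(* c e <= r / 4 keeps the trajectory and every shorter competitor in the box; M e <= 1 / 2 controls
   the gradient of the bending term. *)
pose e := Num.min T (Num.min (r / 4 / c) (2 * M)^-1).
have e0 : 0 < e by rewrite !lt_min T0 !divr_gt0// invr_gt0 mulr_gt0.
have eT : e <= T by rewrite ge_min lexx.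
have ce : c * e <= r / 4.
  by rewrite mulrC -ler_pdivlMr// /e !ge_min lexx orbT.
have eM : M * e <= 1 / 2.
  rewrite -ler_pdivlMl// (_ : M^-1 * (1 / 2) = (2 * M)^-1).
    by rewrite /e !ge_min lexx !orbT.
  by field; rewrite gt_eqF.
have traj t : 0 <= t <= e -> `|x t - x 0| <= r / 4 /\ `|y t - y 0| <= r / 4.
  move=> /andP[t0 te]; have tT := le_trans te eT.
  have := ham_x_lipschitz fF H (ltW c0) Ec (lexx 0) t0 tT.
  have := ham_y_lipschitz fF H (ltW c0) Ec (lexx 0) t0 tT.
  have : c * (t - 0) <= c * e by rewrite ler_pM2l// subr0.
  by split; lra.
have HJ X Y t : `|X - x 0| <= r / 4 -> `|Y - y 0| <= r / 4 -> 0 <= t <= e ->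
   ((u t - M * t * (X - x t)) ^+ 2 + (v t - M * t * (Y - y t)) ^+ 2
     + w ^+ 2 * f (Num.sqrt (X ^+ 2 + Y ^+ 2)) ^+ 2) / 2
   + calibration_dt f w c M x y u v X Y t <= 0.
  move=> hX hY te; have [hx hy] := traj t te; move/andP: te => [t0 te].
  have [_ h] := KG _ _ _ _ (planar_box (ltW rpos) rE hx hy)
    (planar_box (ltW rpos) rE hX hY).
  apply: (hamilton_jacobi_ineq _ h).
  - have tT : 0 <= t <= T by rewrite t0 (le_trans te).
    by rewrite -Ec -(energy_cst fF H tT).
  - by rewrite /M; lra.
  - have h1 : M * t <= 1 / 2 by rewrite (le_trans _ eM)// ler_pM2l.
    have h0 : 0 <= M * t by rewrite mulr_ge0// ltW.
    by nra.
(* S_t <= 0 follows from the Hamilton-Jacobi inequality because the Hamiltonian is nonnegative. *)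
have HJ0 X Y t : `|X - x 0| <= r / 4 -> `|Y - y 0| <= r / 4 -> 0 <= t <= e ->
    calibration_dt f w c M x y u v X Y t <= 0.
  move=> hX hY te; apply: le_trans (HJ X Y t hX hY te).
  by rewrite lerDr divr_ge0// -exprMn !addr_ge0// sqr_ge0.
clearbody r M e.
exists e; split=> // T' X Y Z adm X0 Y0 Z0 Xe Ye Ze.
rewrite leNgt; apply/negP => short.
have [F [acF F0 ndF FT aeF]] := arc_length fF adm.
have [T'0 [acX [acY [acZ _]]]] := adm.
pose l := F T'.
have lce : l < c * e by rewrite -lte_fin (le_lt_trans FT).
have Fpos t : 0 <= t <= T' -> 0 <= F t <= l.
  by move=> /andP[t0 tT]; rewrite -{1}F0 !ndF.
have near_start t : 0 <= t <= T' ->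
    `|X t - x 0| <= r / 4 /\ `|Y t - y 0| <= r / 4.
  move=> tT'; have Fl : F t <= l by case/andP: (Fpos t tT').
  have [hx hy] := arc_length_dist acX acY acF F0 aeF tT'.
  by rewrite -X0 -Y0; split; lra.
have /andP[l0 _] : 0 <= F T' <= l by apply: Fpos; rewrite T'0 lexx.
pose W := calibration w c M x y z u v.
(* Hamilton's equations are assumed only on the open interval, so the clock starts at d > 0; the
   cost is the value of S at gamma(0) at time d, which tends to 0. *)
have key d : 0 < d -> d + l / c < e ->
    c ^+ 2 / 2 * e - c / 2 * l <= W (x 0) (y 0) (z 0) d.
  move=> d0 dl.
  pose s t := d + F t / c.
  have sin t : 0 <= t <= T' -> 0 < s t < e.
    move=> /Fpos/andP[Ft0 Ftl]; rewrite /s ltr_wpDr ?divr_ge0 ?(ltW c0)//=.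
    by rewrite (le_lt_trans _ dl)// lerD2l ler_pM2r ?invr_gt0.
  have acs : abs_cont 0 T' s.
    apply: abs_contD; first exact: abs_cont_cst.
    by apply: abs_contM => //; exact: abs_cont_cst.
  have comp p k : 0 <= k -> (forall a b, 0 <= a -> a <= b -> b <= e ->
      `|p b - p a| <= k * (b - a)) -> abs_cont 0 T' (fun t => p (s t)).
    move=> k0 hk; apply: abs_cont_comp k0 hk acs _ => t /sin/andP[? ?].
    by rewrite !ltW.
  have acx : abs_cont 0 T' (fun t => x (s t)).
    apply: (comp _ c (ltW c0)) => a b ha hab hb.
    by apply: (ham_x_lipschitz fF H (ltW c0) Ec) => //; exact: le_trans eT.
  have acy : abs_cont 0 T' (fun t => y (s t)).
    apply: (comp _ c (ltW c0)) => a b ha hab hb.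
    by apply: (ham_y_lipschitz fF H (ltW c0) Ec) => //; exact: le_trans eT.
  have acz : abs_cont 0 T' (fun t => z (s t)).
    have [Kz Kz0 hz] := ham_z_lipschitz fF H (ltW c0) Ec.
    by apply: (comp _ Kz Kz0) => a b ha hab hb; apply: hz => //; exact: le_trans eT.
  pose B := `|x 0| + `|y 0| + r / 4.
  have B0 : 0 <= B by rewrite !addr_ge0// divr_ge0// ltW.
  have hB t : 0 <= t <= e -> `|x t| <= B /\ `|y t| <= B.
    move=> /traj[hx hy].
    have h1 : `|x t| <= `|x t - x 0| + `|x 0|.
      by rewrite (le_trans _ (ler_normD _ _))// subrK.
    have h2 : `|y t| <= `|y t - y 0| + `|y 0|.
      by rewrite (le_trans _ (ler_normD _ _))// subrK.
    have := normr_ge0 (x 0); have := normr_ge0 (y 0).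
    by rewrite /B => ? ?; split; lra.
  have hG t : 0 <= t <= e -> `|sqr_slope f (rad x y t)| <= G.
    move=> /traj[hx hy]; have b := planar_box (ltW rpos) rE hx hy.
    by have [] := KG _ _ _ _ b b.
  have Ku0 := mulr_ge0 (mulr_ge0 (sqr_ge0 w) G0) B0.
  have uv_lip := ham_u_lipschitz (ltW e0) eT G0 hG hB.
  have acu : abs_cont 0 T' (fun t => u (s t)).
    by apply: (comp _ _ Ku0) => a b ha hab hb; have [] := uv_lip a b ha hab hb.
  have acv : abs_cont 0 T' (fun t => v (s t)).
    by apply: (comp _ _ Ku0) => a b ha hab hb; have [] := uv_lip a b ha hab hb.
  (* At speed c, a gain of c^2 / 2 per unit time is c / 2 per unit length; this allowance is
     subtracted. *)
  pose P t := W (X t) (Y t) (Z t) (s t) + - (c / 2) * F t.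
  have acP : abs_cont 0 T' P.
    have acB g p : abs_cont 0 T' g -> abs_cont 0 T' p ->
      abs_cont 0 T' (fun t => g t + - p t).
      by move=> acg acp; apply: abs_contD acg (abs_contN acp).
    have accM k p : abs_cont 0 T' p -> abs_cont 0 T' (fun t => k * p t).
      by move=> acp; apply: abs_contM acp; exact: abs_cont_cst.
    have aX := acB _ _ acX acx; have aY := acB _ _ acY acy.
    have aZ := acB _ _ acZ acz.
    apply: abs_contD; last exact: accM.
    apply: abs_contD; last first.
      apply: accM; apply: abs_contM acs _.
      by apply: abs_contD; [exact: (abs_contM aX aX)|exact: (abs_contM aY aY)].
    apply: abs_contD; last exact: accM.
    apply: abs_contD; last exact: accM.
    by apply: abs_contD; [exact: (abs_contM acu aX)|exact: (abs_contM acv aY)].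
  have Pmono : P T' <= P 0.
    apply: (abs_cont_le T'0 acP); apply: (lebesgue_aeS _ aeF) => t h tT'.
    have [dX dY dZ dF [F'0 hp]] := h tT'.
    have is1 (p : R -> R) : derivable p t 1 -> is_derive t 1 p (derive1 p t).
      by move=> ?; apply/is_derive1_derivable.
    have ds : is_derive t 1 s (derive1 F t / c).
      have h1 := is_derive1D (is_derive_cst d t 1)
        (is_derive1M (is1 _ dF) (is_derive_cst c^-1 t 1)).
      by apply: is_derive_eq h1 _; rewrite /cst; ring.
    have st := sin t tT'; have st' : 0 <= s t <= e by case/andP: st => *; rewrite !ltW.
    have stT : 0 < s t < T by case/andP: st => -> /lt_le_trans->.
    have hW := calibration_derive M fF H Ec stT (is1 _ dX) (is1 _ dY) (is1 _ dZ) ds.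
    have hP : is_derive t 1 P _ := is_derive1D hW
      (is_derive1M (is_derive_cst (- (c / 2)) t 1) (is1 _ dF)).
    have /is_derive1_derivable[dP ->] := hP; split; first exact: dP.
    have [hX hY] := near_start t tT'.
    have := HJ _ _ _ hX hY st'.
    set p1 := u (s t) - _; set p2 := v (s t) - _.
    set N2 := p1 ^+ 2 + _ + _; set b := calibration_dt _ _ _ _ _ _ _ _ _ _ _.
    have N20 : 0 <= N2 by rewrite /N2 -exprMn !addr_ge0// sqr_ge0.
    have := hp p1 p2 w (Num.sqrt N2) (sqrtr_ge0 _).
    rewrite sqr_sqrtr// => /(_ (lexx _)).
    have := sqr_sqrtr N20; have := sqrtr_ge0 N2.
    rewrite /cst mul0r add0r.
    (* Everything is expressed by the clock rate q = s' = F' / c, which then factors out of P'. *)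
    move: F'0; have -> : derive1 F t = derive1 F t / c * c by rewrite divfK// gt_eqF.
    rewrite mulfK ?gt_eqF// pmulr_lge0//.
    set N := Num.sqrt N2; set q := derive1 F t / c => q0 N0 NE le1 le2.
    have : q * (c * N + b - c ^+ 2 / 2) <= 0.
      by rewrite mulr_ge0_le0//; apply: young_le0; rewrite NE.
    by lra.
  have dlT : d + l / c <= e by exact: ltW.
  have qe : W (x e) (y e) (z e) e = c ^+ 2 / 2 * e.
    by rewrite /W /calibration !subrr; ring.
  have cW := @within_calibration _ _ _ c M _ _ _ _ _ _ H (x e) (y e) (z e).
  have endmono : W (x e) (y e) (z e) e <= W (x e) (y e) (z e) (d + l / c).
    have [hxe hye] : `|x e - x 0| <= r / 4 /\ `|y e - y 0| <= r / 4.
      by apply: traj; rewrite lexx ltW.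
    have lc0 : 0 <= l / c by rewrite divr_ge0// ltW.
    have dW t : t \in `](d + l / c), e[ ->
        is_derive t 1 (W (x e) (y e) (z e))
          (calibration_dt f w c M x y u v (x e) (y e) t).
      rewrite in_itv/= => /andP[t1 t2].
      have tT : 0 < t < T.
        by apply/andP; lra.
      have hW := calibration_derive M fF H Ec tT (is_derive_cst (x e) t 1)
        (is_derive_cst (y e) t 1) (is_derive_cst (z e) t 1) (is_derive_id t 1).
      by apply: is_derive_eq hW _; rewrite /cst !mulr0 !add0r mulr1.
    have := @ler0_derive1_le _ (W (x e) (y e) (z e)) (d + l / c) e _ _ true false.
    move=> /(_ (fun t ht => proj1 ((is_derive1_derivable _ _ _).1 (dW t ht)))).
    apply; rewrite ?in_itv/= ?lexx ?dlT//.
      move=> t ht; have /is_derive1_derivable[_ ->] := dW t ht.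
      move: ht; rewrite in_itv/= => /andP[t1 t2]; apply: HJ0 => //.
      by apply/andP; lra.
    apply: continuous_subspaceW cW => t; rewrite /= !in_itv/= => /andP[t1 t2].
    by apply/andP; lra.
  rewrite -qe; move: Pmono; rewrite /P /s F0 mul0r addr0 mulr0 addr0.
  rewrite X0 Y0 Z0 Xe Ye Ze -/l.
  lra.
have W0 : W (x 0) (y 0) (z 0) 0 = 0 by rewrite /W /calibration !subrr; ring.
have gap : 0 < c ^+ 2 / 2 * e - c / 2 * l.
  have -> : c ^+ 2 / 2 * e - c / 2 * l = c / 2 * (c * e - l) by field.
  by rewrite mulr_gt0 ?divr_gt0// subr_gt0.
have /within_itvP cW := @within_calibration _ _ _ c M _ _ _ _ _ _ H (x 0) (y 0) (z 0).
have [|d' d'0 d'P] := cW 0 _ _ gap; first by rewrite lexx ltW.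
have lc : l / c < e by rewrite ltr_pdivrMr// mulrC.
have lc0 : 0 <= l / c by rewrite divr_ge0// ltW.
(* The first bound makes S at gamma(0) smaller than [gap]; the second lets the competitor still
   arrive before [e]. *)
pose d := Num.min (d' / 2) ((e - l / c) / 2).
have dpos : 0 < d by rewrite lt_min !divr_gt0// subr_gt0.
have d1 : d <= d' / 2 by rewrite ge_min lexx.
have d2 : d <= (e - l / c) / 2 by rewrite ge_min lexx orbT.
have := key d dpos; have := d'P d; rewrite -/W W0 !sub0r !normrN (gtr0_norm dpos).
have -> : 0 <= d <= T by apply/andP; lra.
have -> : d < d' by lra.
have -> : d + l / c < e by lra.
move=> /(_ isT isT)/(le_lt_trans (ler_norm _)) h1 /(_ isT); lra.
Qed.

End off_axis.

(** * Calibration on the axis *)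

(** Integrating from -1 rather than 0 gives a two-sided derivative at r = 0, hence continuity of [G]
    there. *)
Lemma primitive_gtN1 (R : realType) (g : R -> R) : continuous g ->
  exists G : R -> R, forall r : R, -1 < r -> is_derive r 1 G (g r).
Proof.
move=> cg.
exists (fun r => (\int[@lebesgue_measure R]_(t in
   [set` Interval (BLeft (-1)) (BRight r)]) g t)%R).
move=> r r1; apply/is_derive1_derivable.
apply: (@continuous_FTC1 _ g (BLeft (-1)) r (r + 1)).
- by rewrite ltrDl.
- apply: continuous_compact_integrable; first exact: segment_compact.
  exact: continuous_subspaceT.
- by rewrite lte_fin.
- exact: cg.
Qed.

(** After multiplication by the sum of the two roots, positive since k > 0, a difference of squares
    remains; each factor |a + a'| or |b + b'| is at most that sum. *)
Lemma sqrt3_lipschitz (R : rcfType) (a b a' b' k : R) : 0 < k ->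
  `|Num.sqrt (a ^+ 2 + b ^+ 2 + k ^+ 2) - Num.sqrt (a' ^+ 2 + b' ^+ 2 + k ^+ 2)|
  <= `|a - a'| + `|b - b'|.
Proof.
move=> k0; set A := Num.sqrt _; set B := Num.sqrt _.
have pos (p q : R) : 0 < p ^+ 2 + q ^+ 2 + k ^+ 2.
  by rewrite ltr_wpDl ?exprn_gt0// addr_ge0// sqr_ge0.
have A0 : 0 < A by rewrite sqrtr_gt0.
have B0 : 0 < B by rewrite sqrtr_gt0.
have AE : A ^+ 2 = a ^+ 2 + b ^+ 2 + k ^+ 2 by rewrite sqr_sqrtr// ltW.
have BE : B ^+ 2 = a' ^+ 2 + b' ^+ 2 + k ^+ 2 by rewrite sqr_sqrtr// ltW.
have le (p P : R) : 0 <= P -> p ^+ 2 <= P ^+ 2 -> `|p| <= P.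
  by move=> P0; rewrite -[p ^+ 2]real_normK ?num_real// ler_pXn2r ?nnegrE.
have sa := sqr_ge0 a; have sb := sqr_ge0 b; have sk := sqr_ge0 k.
have sa' := sqr_ge0 a'; have sb' := sqr_ge0 b'.
have ha : `|a| <= A by apply: le; [exact: ltW|lra].
have hb : `|b| <= A by apply: le; [exact: ltW|lra].
have ha' : `|a'| <= B by apply: le; [exact: ltW|lra].
have hb' : `|b'| <= B by apply: le; [exact: ltW|lra].
have AB : 0 < A + B by rewrite addr_gt0.
rewrite -(ler_pM2r AB) -[X in _ * X <= _](gtr0_norm AB) -normrM.
have -> : (A - B) * (A + B) = (a - a') * (a + a') + (b - b') * (b + b').
  have -> : (A - B) * (A + B) = A ^+ 2 - B ^+ 2 by ring.
  by rewrite AE BE; ring.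
apply: (le_trans (ler_normD _ _)); rewrite !normrM mulrDl.
apply: lerD; apply: ler_wpM2l => //; apply: (le_trans (ler_normD _ _)); lra.
Qed.

Lemma rad_eq0 (R : realType) (x y : R -> R) (t : R) :
  rad x y t = 0 -> x t = 0 /\ y t = 0.
Proof.
move=> r0; have := rad_sqr x y t; rewrite r0 expr0n/= => h.
have := sqr_ge0 (x t); have := sqr_ge0 (y t) => ? ?.
by split; apply/eqP; rewrite -sqrf_eq0; apply/eqP; lra.
Qed.

(** * Trajectories issuing from the axis *)

Section on_axis.
Context (R : realType) (f : R -> R) (w c T : R) (x y z u v : R -> R).
Hypothesis fF : in_frakF f.
Hypothesis H : ham_flow f T w x y z u v.
Hypothesis c0 : 0 < c.
Hypothesis Ec : energy f w x y u v 0 = c ^+ 2.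
Hypothesis r0 : rad x y 0 = 0.

Let x0 : x 0 = 0. Proof. by have [] := rad_eq0 r0. Qed.
Let y0 : y 0 = 0. Proof. by have [] := rad_eq0 r0. Qed.

(** The force is radial, so x v - y u is conserved, and it vanishes on the axis. *)
Lemma angular_momentum0 t : 0 <= t <= T -> x t * v t = y t * u t.
Proof.
pose L s := x s * v s + - (y s * u s).
suff h : forall s, 0 <= s <= T -> L s = L 0.
  by move=> /h; rewrite /L x0 y0 !mul0r subrr => /eqP; rewrite subr_eq0 => /eqP.
apply: const_of_derive.
  apply: within_contD; first exact: within_contM (ham_cx H) (ham_cv H).
  by apply: within_contN; exact: within_contM (ham_cy H) (ham_cu H).
move=> s sT.
have h := is_derive1D (is_derive1M (ham_dx H sT) (ham_dv H sT))
  (is_derive1N (is_derive1M (ham_dy H sT) (ham_du H sT))).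
by apply: is_derive_eq h _; ring.
Qed.

(** The quantity is r r'. On the axis f = 0, so all the energy is planar: (u, v) starts with norm c,
    and (x, y) is close to t (u(0), v(0)) for small t. Hence r r' is close to t c^2. *)
Lemma leaves_axis : exists e, [/\ 0 < e, e <= T &
  forall t, 0 < t <= e -> 0 < x t * u t + y t * v t].
Proof.
have T0 := ham_T H.
have Ec0 : u 0 ^+ 2 + v 0 ^+ 2 = c ^+ 2.
  have f0 : f 0 = 0 by case: fF => [[_ []]].
  by rewrite -Ec /energy r0 f0 expr0n/= mulr0 addr0.
(* Four error terms will each be at most t c^2 / 8, leaving half of the main term t c^2. *)
have c8 : 0 < c / 8 by rewrite divr_gt0.
have T00 : (0 : R) <= 0 <= T by rewrite lexx ltW.
have /within_itvP/(_ 0 T00 _ c8)[d1 d10 h1] := ham_cu H.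
have /within_itvP/(_ 0 T00 _ c8)[d2 d20 h2] := ham_cv H.
pose e := Num.min T (Num.min (d1 / 2) (d2 / 2)).
have e0 : 0 < e by rewrite !lt_min T0 !divr_gt0.
have eT : e <= T by rewrite ge_min lexx.
have ed1 : e <= d1 / 2 by rewrite !ge_min lexx orbT.
have ed2 : e <= d2 / 2 by rewrite !ge_min lexx !orbT.
exists e; split=> // t /andP[t0 te].
have tT : 0 <= t <= T by apply/andP; lra.
have hu s : 0 <= s <= t -> `|u s - u 0| <= c / 8.
  move=> /andP[s0 st]; rewrite distrC ltW// h1 ?sub0r ?normrN ?ger0_norm//.
    by apply/andP; lra.
  by lra.
have hv s : 0 <= s <= t -> `|v s - v 0| <= c / 8.
  move=> /andP[s0 st]; rewrite distrC ltW// h2 ?sub0r ?normrN ?ger0_norm//.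
    by apply/andP; lra.
  by lra.
have lin (p q : R -> R) : {within `[0, T], continuous p} -> p 0 = 0 ->
    (forall s, 0 < s < T -> is_derive s 1 p (q s)) ->
    (forall s, 0 <= s <= t -> `|q s - q 0| <= c / 8) ->
    `|p t - q 0 * t| <= c / 8 * t.
  move=> cp p0 dp hq.
  have := @lipschitz_of_derive _ (fun s => p s + - q 0 * s) 0 t (c / 8) (ltW t0).
  rewrite p0 mulr0 addr0 !subr0 mulNr; apply.
    apply: within_contD.
      apply: continuous_subspaceW cp => s; rewrite /= !in_itv/= => /andP[-> st].
      by rewrite (le_trans st)//; lra.
    apply: within_contM; first by move=> s; exact: cst_continuous.
    by apply: continuous_subspaceT => s; exact: cvg_id.
  move=> s /andP[s0 st]; exists (q s - q 0); last by apply: hq; rewrite !ltW.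
  have sT : 0 < s < T by apply/andP; lra.
  have h := is_derive1D (dp s sT)
    (is_derive1M (is_derive_cst (- q 0) s 1) (is_derive_id s 1)).
  by apply: is_derive_eq h _; rewrite /cst mul0r add0r mulr1.
have := lin _ _ (ham_cx H) x0 (ham_dx H) hu.
have := lin _ _ (ham_cy H) y0 (ham_dy H) hv.
have tt : 0 <= t <= t by rewrite lexx ltW.
have := hu t tt; have := hv t tt.
have hE := energy_cst fF H tT; rewrite Ec /energy in hE.
have hw : 0 <= w ^+ 2 * f (rad x y t) ^+ 2 by rewrite -exprMn sqr_ge0.
have su := sqr_ge0 (u t); have sv := sqr_ge0 (v t).
have le (p : R) : p ^+ 2 <= c ^+ 2 -> `|p| <= c.
  by rewrite -[p ^+ 2]real_normK ?num_real// ler_pXn2r ?nnegrE// ltW.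
have bu : `|u t| <= c by apply: le; lra.
have bv : `|v t| <= c by apply: le; lra.
have su0 := sqr_ge0 (u 0); have sv0 := sqr_ge0 (v 0).
have bu0 : `|u 0| <= c by apply: le; lra.
have bv0 : `|v 0| <= c by apply: le; lra.
move=> qv qu ly lx.
have -> : x t * u t + y t * v t = t * (u 0 ^+ 2 + v 0 ^+ 2)
  + (t * (u 0 * (u t - u 0)) + t * (v 0 * (v t - v 0)))
  + ((x t - u 0 * t) * u t + (y t - v 0 * t) * v t) by ring.
have prod (a b A B : R) : `|a| <= A -> `|b| <= B -> - (A * B) <= a * b.
  move=> ha hb; have : `|a * b| <= A * B by rewrite normrM; exact: ler_pM.
  by rewrite ler_norml => /andP[].
have p1 := prod _ _ _ _ bu0 qu; have p2 := prod _ _ _ _ bv0 qv.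
have p3 := prod _ _ _ _ lx bu; have p4 := prod _ _ _ _ ly bv.
have {}p1 := ler_wpM2l (ltW t0) p1; have {}p2 := ler_wpM2l (ltW t0) p2.
rewrite Ec0.
have : 0 < t * c ^+ 2 by rewrite mulr_gt0// exprn_gt0.
have e1 : t * - (c * (c / 8)) = - (t * c ^+ 2 / 8) by ring.
have e2 : - (c / 8 * t * c) = - (t * c ^+ 2 / 8) by ring.
rewrite e1 in p1 p2; rewrite e2 in p3 p4.
lra.
Qed.

End on_axis.

Section on_axis_minimizing.
Context (R : realType) (f : R -> R) (w c T : R) (x y z u v : R -> R).
Hypothesis fF : in_frakF f.
Hypothesis H : ham_flow f T w x y z u v.
Hypothesis c0 : 0 < c.
Hypothesis Ec : energy f w x y u v 0 = c ^+ 2.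
Hypothesis r0 : rad x y 0 = 0.

(** The radial momentum |(u, v)| left by the energy at distance r. Where w^2 f^2 exceeds c^2 the
    square root is 0 by convention, so the eikonal identity is used only below that threshold. *)
Let g (r : R) := Num.sqrt (c ^+ 2 - w ^+ 2 * f `|r| ^+ 2).

Let cg : continuous g.
Proof.
move=> r; apply: (@continuous_comp _ _ _
  (fun r : R => c ^+ 2 - w ^+ 2 * f `|r| ^+ 2) Num.sqrt).
  have cf : {for r, continuous (fun r : R => f `|r|)} by exact: f_normr_continuous.
  have cc (k : R) : {for r, continuous (fun=> k : R)} by exact: cst_continuous.
  apply: (@continuous_atD _ (fun=> c ^+ 2) (fun r => - (w ^+ 2 * f `|r| ^+ 2))) => //.
  apply: (@continuousN _ _ _ (fun r : R => w ^+ 2 * f `|r| ^+ 2)).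
  apply: (@continuous_atM _ (fun=> w ^+ 2) (fun r => f `|r| ^+ 2)) => //.
  exact: (@continuous_atM _ (fun r : R => f `|r|) (fun r : R => f `|r|)).
exact: sqrt_continuous.
Qed.

Let g_ge0 r : 0 <= g r. Proof. exact: sqrtr_ge0. Qed.

Let g_le r : g r <= c.
Proof.
have h : g r <= Num.sqrt (c ^+ 2).
  by apply: ler_wsqrtr; rewrite lerBlDr lerDl -exprMn sqr_ge0.
by rewrite (le_trans h)// sqrtr_sqr gtr0_norm.
Qed.

Let f_le r s : 0 <= r -> r <= s -> f r ^+ 2 <= f s ^+ 2.
Proof.
move=> r_ge0; rewrite le_eqVlt => /predU1P[->//|rs].
have [_ [_ [_ [[mf _] _]]]] := fF.
rewrite ler_pXn2r ?nnegrE ?frakF_ge0//; last exact: le_trans (ltW rs).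
exact/ltW/mf.
Qed.

Section primitive.
Variable G : R -> R.
Hypothesis dG : forall r : R, -1 < r -> is_derive r 1 G (g r).

Let within_G a b : -1 < a -> {within `[a, b], continuous G}.
Proof.
move=> a1; apply: continuous_in_subspaceT => r; rewrite inE/= in_itv/=.
move=> /andP[ar _]; have /is_derive1_derivable[d _] := dG (lt_le_trans a1 ar).
exact: derivable_cts.
Qed.

Let G_lipschitz a b : 0 <= a -> 0 <= b -> `|G b - G a| <= c * `|b - a|.
Proof.
wlog ab : a b / a <= b.
  move=> h a0 b0; have [ab|/ltW ba] := leP a b; first exact: h.
  by rewrite distrC (distrC b); exact: h.
move=> a0 b0; rewrite (ger0_norm (_ : 0 <= b - a)) ?subr_ge0//.
apply: lipschitz_of_derive => //; first by apply: within_G; lra.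
move=> r /andP[ar rb]; exists (g r); first by apply: dG; lra.
by rewrite ger0_norm.
Qed.

Let G_mono a b : 0 <= a -> a <= b -> G a <= G b.
Proof.
move=> a0; rewrite le_eqVlt => /predU1P[->//|ab].
have dGab r : r \in `]a, b[ -> is_derive r 1 G (g r).
  by rewrite in_itv/= => /andP[ar _]; apply: dG; lra.
have [|r _ h] := MVT ab dGab; first by apply: within_G; lra.
by rewrite -subr_ge0 h mulr_ge0// subr_ge0 ltW.
Qed.

(* Along the trajectory the calibration [w z + G r] grows at the rate c^2:
   the motion is radial, so r' = sqrt (u^2 + v^2) = G' r. *)
Lemma on_axis_action e : 0 < e -> e <= T ->
  (forall t, 0 < t <= e -> 0 < x t * u t + y t * v t) ->
  w * (z e - z 0) + (G (rad x y e) - G 0) = c ^+ 2 * e.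
Proof.
move=> e0 eT out.
have sub (p : R -> R) : {within `[0, T], continuous p} -> {within `[0, e], continuous p}.
  apply: continuous_subspaceW => r; rewrite /= !in_itv/= => /andP[-> re].
  exact: le_trans eT.
pose S t := w * z t + G (rad x y t) + - c ^+ 2 * t.
have cc (k : R) : {within `[0, e], continuous (fun _ : R => k)}.
  by move=> t; exact: cst_continuous.
have crad : {within `[0, e], continuous (rad x y)}.
  apply: within_cont_comp; last exact: sqrt_continuous.
  have cx := sub _ (ham_cx H); have cy := sub _ (ham_cy H).
  apply: within_contD; first exact: (within_contM cx cx).
  exact: (within_contM cy cy).
have cGr : {within `[0, e], continuous (fun t => G (rad x y t))}.
  apply/within_itvP => s se eps eps0.
  have epsc : 0 < eps / c by rewrite divr_gt0.
  have /within_itvP/(_ s se _ epsc)[d d0 dP] := crad.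
  exists d => // t te st; rewrite (le_lt_trans (G_lipschitz _ _)) ?rad_ge0//.
  by rewrite mulrC -ltr_pdivlMr// dP.
suff h : forall t, 0 <= t <= e -> S t = S 0.
  have := h e; rewrite lexx (ltW e0) /S r0 mulr0 => /(_ isT); lra.
apply: const_of_derive.
  apply: within_contD; first apply: within_contD => //.
    exact: within_contM (cc w) (sub _ (ham_cz H)).
  apply: within_contM (cc _) _.
  by apply: continuous_subspaceT => t; exact: cvg_id.
move=> t /andP[t0 te].
have tT : 0 < t < T by rewrite t0 (lt_le_trans te).
have tT' : 0 <= t <= T by case/andP: tT => *; rewrite !ltW.
have q0 : 0 < x t * u t + y t * v t by apply: out; rewrite t0 ltW.
have am := angular_momentum0 H r0 tT'.
have hE := energy_cst fF H tT'; rewrite Ec /energy in hE.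
(* Lagrange's identity with zero angular momentum: equality in Cauchy-Schwarz. *)
have qE : (x t * u t + y t * v t) ^+ 2 =
    (x t ^+ 2 + y t ^+ 2) * (u t ^+ 2 + v t ^+ 2).
  have -> : (x t ^+ 2 + y t ^+ 2) * (u t ^+ 2 + v t ^+ 2) =
    (x t * u t + y t * v t) ^+ 2 + (x t * v t - y t * u t) ^+ 2 by ring.
  by rewrite am subrr expr0n/= addr0.
have rr : 0 < x t ^+ 2 + y t ^+ 2.
  rewrite lt_neqAle addr_ge0 ?sqr_ge0// andbT eq_sym; apply/eqP => r2.
  have : (x t * u t + y t * v t) ^+ 2 = 0 by rewrite qE r2 mul0r.
  by move/eqP; rewrite sqrf_eq0 => /eqP q_0; move: q0; rewrite q_0 ltxx.
have rpos : 0 < rad x y t by rewrite sqrtr_gt0.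
(* That is, G'(r) = r'; the sign is settled by the outward motion. *)
have gE : g (rad x y t) * rad x y t = x t * u t + y t * v t.
  rewrite /g (ger0_norm (ltW rpos)) -hE addrK /rad -sqrtrM ?addr_ge0 ?sqr_ge0//.
  by rewrite mulrC -qE sqrtr_sqr gtr0_norm.
have hr := @is_derive1_comp _ _ (fun s => x s ^+ 2 + y s ^+ 2) t _ _
  (is_derive1_sqrt rr) (sqr_norm_derive (ham_dx H tT) (ham_dy H tT)).
have rN1 : -1 < rad x y t by rewrite (lt_trans _ rpos)// ltrN10.
have hG := @is_derive1_comp _ G (rad x y) t _ _ (dG rN1) hr.
have h := is_derive1D (is_derive1D (is_derive1M (is_derive_cst w t 1) (ham_dz H tT)) hG)
  (is_derive1M (is_derive_cst (- c ^+ 2) t 1) (is_derive_id t 1)).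
apply: is_derive_eq h _.
rewrite -/(rad x y t) -gE /cst -hE.
have g2 : g (rad x y t) ^+ 2 = u t ^+ 2 + v t ^+ 2.
  by rewrite /g (ger0_norm (ltW rpos)) -hE addrK sqr_sqrtr// addr_ge0 ?sqr_ge0.
rewrite -g2; field; exact: lt0r_neq0.
Qed.

(* Smoothing r into sqrt (r^2 + k^2) only increases f, so the smoothed function
   is still a subsolution of the eikonal equation. *)
Lemma on_axis_calibration (T' k : R) (X Y Z F : R -> R) : 0 < k ->
  abs_cont 0 T' X -> abs_cont 0 T' Y -> abs_cont 0 T' Z -> abs_cont 0 T' F ->
  0 <= T' -> F 0 = 0 ->
  (forall t, 0 <= t <= T' ->
     w ^+ 2 * f (Num.sqrt (X t ^+ 2 + Y t ^+ 2 + k ^+ 2)) ^+ 2 <= c ^+ 2) ->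
  arc_majorant f T' X Y Z F ->
  w * (Z T' - Z 0) + (G (Num.sqrt (X T' ^+ 2 + Y T' ^+ 2 + k ^+ 2))
    - G (Num.sqrt (X 0 ^+ 2 + Y 0 ^+ 2 + k ^+ 2))) <= c * F T'.
Proof.
move=> k0 acX acY acZ acF T'0 F0 small aeF.
pose rho t := Num.sqrt (X t ^+ 2 + Y t ^+ 2 + k ^+ 2).
pose S t := w * Z t + G (rho t).
have acS : abs_cont 0 T' S.
  apply: abs_contD; first by apply: abs_contM => //; exact: abs_cont_cst.
  apply: (abs_cont_dom (K := c) acX acY) => s t s0 st tT.
  apply: (le_trans (G_lipschitz _ _)); rewrite ?sqrtr_ge0//.
  by apply: ler_wpM2l; [exact: ltW|exact: sqrt3_lipschitz].
have accF : abs_cont 0 T' (fun t => c * F t).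
  by apply: abs_contM => //; exact: abs_cont_cst.
suff : S T' - S 0 <= c * F T' - c * F 0 by rewrite F0 mulr0 /S /rho; lra.
apply: (abs_cont_increment_le acS accF); last by rewrite T'0 lexx.
apply: (lebesgue_aeS _ aeF) => t h tT.
have [dX dY dZ dF [_ hp]] := h tT.
have is1 (p : R -> R) : derivable p t 1 -> is_derive t 1 p (derive1 p t).
  by move=> ?; apply/is_derive1_derivable.
have R0 : 0 <= X t ^+ 2 + Y t ^+ 2 by rewrite addr_ge0// sqr_ge0.
have k2 : 0 < k ^+ 2 by rewrite exprn_gt0.
have rho2 : 0 < X t ^+ 2 + Y t ^+ 2 + k ^+ 2 by rewrite ltr_wpDl.
have rho0 : 0 < rho t by rewrite sqrtr_gt0.
have rhoE : rho t ^+ 2 = X t ^+ 2 + Y t ^+ 2 + k ^+ 2 by rewrite sqr_sqrtr// ltW.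
have hq := is_derive1D (sqr_norm_derive (is1 _ dX) (is1 _ dY))
  (is_derive_cst (k ^+ 2) t 1).
have hrho := @is_derive1_comp _ _ (fun s => X s ^+ 2 + Y s ^+ 2 + k ^+ 2) t _ _
  (is_derive1_sqrt rho2) hq.
have rhoN1 : -1 < rho t by rewrite (lt_trans _ rho0)// ltrN10.
have hG := @is_derive1_comp _ G rho t _ _ (dG rhoN1) hrho.
have hS := is_derive1D (is_derive1M (is_derive_cst w t 1) (is1 _ dZ)) hG.
have hcF := is_derive1M (is_derive_cst c t 1) (is1 _ dF).
set p1 := g (rho t) * X t / rho t; set p2 := g (rho t) * Y t / rho t.
exists (p1 * derive1 X t + p2 * derive1 Y t + w * derive1 Z t), (c * derive1 F t).
split.
- apply: is_derive_eq hS _; rewrite -/(rho t) /p1 /p2 /cst.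
  by field; exact: lt0r_neq0.
- by apply: is_derive_eq hcF _; rewrite /cst; ring.
- apply: hp; first exact: ltW.
  have hsmall := small t tT; rewrite -/(rho t) in hsmall.
  have g2 : g (rho t) ^+ 2 = c ^+ 2 - w ^+ 2 * f (rho t) ^+ 2.
    by rewrite /g (gtr0_norm rho0) sqr_sqrtr// subr_ge0.
  have Rrho : rad X Y t <= rho t by apply: ler_wsqrtr; rewrite lerDl ltW.
  have fR := f_le (rad_ge0 X Y t) Rrho.
  have {}fR := ler_wpM2l (sqr_ge0 w) fR.
  have : p1 ^+ 2 + p2 ^+ 2 <= g (rho t) ^+ 2.
    (* Besides its effect on f, the smoothing shrinks the planar gradient by the factor r / rho <=
       1. *)
    have -> : p1 ^+ 2 + p2 ^+ 2 =
        g (rho t) ^+ 2 * ((X t ^+ 2 + Y t ^+ 2) / rho t ^+ 2).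
      by rewrite /p1 /p2; field; exact: lt0r_neq0.
    rewrite ler_piMr ?sqr_ge0// ler_pdivrMr ?exprn_gt0// mul1r rhoE.
    by rewrite lerDl ltW.
  by rewrite g2; lra.
Qed.

(** For a competitor of length l < c e no limit in k is needed. Monotonicity of [G] makes the
    smoothing harmless at the final point, and at the start it costs G(k) - G(0) <= c k, at most
    half of the deficit c (c e - l). *)
Lemma on_axis_minimizing_of_primitive : exists e, [/\ 0 < e, e <= T &
  forall T' X Y Z, admissible f T' X Y Z ->
    X 0 = x 0 -> Y 0 = y 0 -> Z 0 = z 0 ->
    X T' = x e -> Y T' = y e -> Z T' = z e ->
    ((c * e)%:E <= length f T' X Y Z)%E].
Proof.
have [e1 [e10 e1T out]] := leaves_axis fF H c0 Ec r0.
have [C [d [C0 d0 Cd]]] := frakF_sqr_bound fF.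
have [x0 y0] := rad_eq0 r0.
pose A := w ^+ 2 * C.
have A0 : 0 <= A by apply: mulr_ge0 => //; exact: sqr_ge0.
have A1 : 0 < A + 1 by rewrite ltr_wpDl.
(* Along a shorter competitor the smoothed radius is at most 2 c e <= d / 2, so the quadratic bound
   on f^2 applies and w^2 f^2 <= 4 A e^2 c^2. The last entry gives A e <= 1 / 2 and e <= 1 / 2,
   hence at most c^2. *)
pose e := Num.min e1 (Num.min (d / 4 / c) (2 * (A + 1))^-1).
have e0 : 0 < e by rewrite !lt_min e10 !divr_gt0// invr_gt0 mulr_gt0.
have ee1 : e <= e1 by rewrite ge_min lexx.
have eT : e <= T := le_trans ee1 e1T.
have ce : c * e <= d / 4.
  by rewrite mulrC -ler_pdivlMr// /e !ge_min lexx orbT.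
have eA : (A + 1) * e <= 1 / 2.
  rewrite -ler_pdivlMl// (_ : (A + 1)^-1 * (1 / 2) = (2 * (A + 1))^-1).
    by rewrite /e !ge_min lexx !orbT.
  by field; exact: lt0r_neq0.
have ce0 : 0 < c * e by rewrite mulr_gt0.
exists e; split=> // T' X Y Z adm X0 Y0 Z0 Xe Ye Ze.
rewrite leNgt; apply/negP => short.
have [F [acF F0 ndF FT aeF]] := arc_length fF adm.
have [T'0 [acX [acY [acZ _]]]] := adm.
pose l := F T'.
have lce : l < c * e by rewrite -lte_fin (le_lt_trans FT).
(* The first bound keeps the smoothed radius below 2 c e, as three squares of size at most (c e)^2
   are added under the root. *)
pose k := Num.min (c * e) ((c * e - l) / 2).
have k0 : 0 < k by rewrite lt_min ce0 divr_gt0// subr_gt0.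
have kce : k <= c * e by rewrite ge_min lexx.
have kl : k <= (c * e - l) / 2 by rewrite ge_min lexx orbT.
have sqr_le (p P : R) : `|p| <= P -> p ^+ 2 <= P ^+ 2.
  move=> h; rewrite -real_normK ?num_real// ler_pXn2r ?nnegrE//.
  exact: le_trans h.
have small t : 0 <= t <= T' ->
    w ^+ 2 * f (Num.sqrt (X t ^+ 2 + Y t ^+ 2 + k ^+ 2)) ^+ 2 <= c ^+ 2.
  move=> tT'; have Fl : F t <= l.
    by case/andP: tT' => t0 tT'; apply: ndF.
  have [hX hY] := arc_length_dist acX acY acF F0 aeF tT'.
  rewrite X0 x0 subr0 in hX; rewrite Y0 y0 subr0 in hY.
  have {}hX : `|X t| <= c * e by lra.
  have {}hY : `|Y t| <= c * e by lra.
  have hk : `|k| <= c * e by rewrite gtr0_norm.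
  have {}hX := sqr_le _ _ hX; have {}hY := sqr_le _ _ hY; have {}hk := sqr_le _ _ hk.
  set q := X t ^+ 2 + Y t ^+ 2 + k ^+ 2.
  have q0 : 0 <= q by rewrite !addr_ge0// sqr_ge0.
  have qle : q <= (2 * (c * e)) ^+ 2.
    rewrite exprMn; have := sqr_ge0 (c * e); rewrite /q.
    have -> : (2 : R) ^+ 2 = 4 by ring.
    by lra.
  have sq : Num.sqrt q <= 2 * (c * e).
    have ce2 : 0 <= 2 * (c * e) by apply: mulr_ge0 => //; exact: ltW.
    by rewrite -(@ler_pXn2r _ 2) ?nnegrE ?sqrtr_ge0// sqr_sqrtr.
  have hf : f (Num.sqrt q) ^+ 2 <= C * Num.sqrt q ^+ 2.
    by apply: Cd; rewrite sqrtr_ge0/=; lra.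
  rewrite sqr_sqrtr// in hf.
  have h1 := ler_wpM2l (sqr_ge0 w) hf.
  apply: (le_trans h1); rewrite mulrA -/A.
  apply: (le_trans (ler_wpM2l A0 qle)).
  have -> : A * (2 * (c * e)) ^+ 2 = (4 * (A * e * e)) * c ^+ 2 by ring.
  rewrite -[leRHS]mul1r ler_wpM2r ?sqr_ge0//.
  have h2 : A * e <= 1 / 2 by rewrite (le_trans _ eA)// ler_wpM2r ?(ltW e0)// lerDl.
  have h3 : e <= 1 / 2.
    by rewrite (le_trans _ eA)// -[leLHS]mul1r ler_wpM2r ?(ltW e0)// lerDr.
  have : A * e * e <= 1 / 2 * (1 / 2).
    have Ae0 : 0 <= A * e by apply: mulr_ge0 => //; exact: ltW.
    exact: ler_pM Ae0 (ltW e0) h2 h3.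
  lra.
have := on_axis_calibration k0 acX acY acZ acF T'0 F0 small aeF.
rewrite X0 Y0 Z0 Xe Ye Ze x0 y0 expr0n/= !add0r -/l sqrtr_sqr (gtr0_norm k0).
have out_e t : 0 < t <= e -> 0 < x t * u t + y t * v t.
  by move=> /andP[t0 te]; apply: out; rewrite t0 (le_trans te).
have := on_axis_action e0 eT out_e.
have : G (rad x y e) <= G (Num.sqrt (x e ^+ 2 + y e ^+ 2 + k ^+ 2)).
  by apply: G_mono; [exact: rad_ge0|apply: ler_wsqrtr; rewrite lerDl sqr_ge0].
have := G_lipschitz (lexx 0) (ltW k0).
rewrite subr0 (gtr0_norm k0) => /(le_trans (ler_norm _)).
have := ler_wpM2l (ltW c0) kl.
have : 0 < c * (c * e - l) by rewrite mulr_gt0// subr_gt0.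
rewrite expr2; lra.
Qed.

End primitive.

Lemma on_axis_minimizing : exists e, [/\ 0 < e, e <= T &
  forall T' X Y Z, admissible f T' X Y Z ->
    X 0 = x 0 -> Y 0 = y 0 -> Z 0 = z 0 ->
    X T' = x e -> Y T' = y e -> Z T' = z e ->
    ((c * e)%:E <= length f T' X Y Z)%E].
Proof.
by have [G dG] := primitive_gtN1 cg; exact: on_axis_minimizing_of_primitive dG.
Qed.

End on_axis_minimizing.

(** * Geodesics *)

Lemma ham_minimizing (R : realType) (f : R -> R) (w c T : R) (x y z u v : R -> R) :
  in_frakF f -> ham_flow f T w x y z u v -> 0 < c ->
  energy f w x y u v 0 = c ^+ 2 ->
  exists e, [/\ 0 < e, e <= T &
    forall T' X Y Z, admissible f T' X Y Z ->
      X 0 = x 0 -> Y 0 = y 0 -> Z 0 = z 0 ->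
      X T' = x e -> Y T' = y e -> Z T' = z e ->
      ((c * e)%:E <= length f T' X Y Z)%E].
Proof.
move=> fF H c0 Ec; have [r0|] := ltP 0 (rad x y 0).
  exact: off_axis_minimizing Ec r0.
rewrite le_eqVlt ltNge sqrtr_ge0 orbF => /eqP r0.
exact: on_axis_minimizing Ec r0.
Qed.

(** A constant curve on the axis is a minimizer of length 0 and carries the lift (0, 0, 1), on which
    the Hamiltonian vanishes; this is why the first part concerns nonconstant curves. *)
Theorem theorem2 (R : realType) (f : R -> R) :
  in_frakF f ->
  (forall (T : R) (x y z : R -> R),
      length_minimizer f T x y z -> constant_speed f T x y z ->
      nonconstant T x y z -> ~ abnormal_lift f T x y z) /\
  (forall (T : R) (x y z : R -> R),
      normal_trajectory f T x y z -> nonconstant T x y z ->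
      geodesic f T x y z).
Proof.
move=> fF; split=> [T x y z [adm _]|T x y z nt nc t /andP[t0 tT]].
  exact: no_abnormal_minimizer.
have [w [u [v H]]] := normal_trajectory_flow nt.
have E0 := energy_gt0 fF H nc.
pose c := Num.sqrt (energy f w x y u v 0).
have c0 : 0 < c by rewrite sqrtr_gt0.
have tT0 : 0 < T - t by rewrite subr_gt0.
have tTT : t + (T - t) <= T by rewrite addrC subrK.
(* The system is autonomous, so the trajectory restarted at time t is again normal, with the same
   momentum w and the same speed c; its initial point decides which calibration applies. *)
have Ht := ham_flow_shift H t0 tT0 tTT.
have Et : energy f w (fun s => x (t + s)) (fun s => y (t + s))
    (fun s => u (t + s)) (fun s => v (t + s)) 0 = c ^+ 2.
  rewrite /c sqr_sqrtr ?(ltW E0)// -(energy_cst fF H (t := t)) ?t0 ?(ltW tT)//.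
  by rewrite /energy /rad !addr0.
have [e [e0 eT min]] := ham_minimizing fF Ht c0 Et.
have teT : t + e <= T by lra.
have He := ham_flow_shift H t0 e0 teT.
exists e => //; split=> //; split.
  split; first exact: ham_admissible fF He (ltW c0) Et.
  move=> T' x' y' z' adm hx hy hz hx' hy' hz'.
  rewrite (ham_length fF He (ltW c0) Et).
  exact: min.
exact: ham_constant_speed fF He (ltW c0) Et.
Qed.
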